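(* Consider the stochastic sub-gradient diffusion algorithm $$\boldsymbol{\psi}_{k,i}=\boldsymbol{w}_{k,i-1}-\mu_k\,\widehat g_k(\boldsymbol{w}_{k,i-1}),\qquad \boldsymbol{w}_{k,i}=\sum_{\ell\in\mathcal N_k}a_{\ell k}\boldsymbol{\psi}_{\ell,i},\qquad k=1,\dots,N,\ i\ge 1,$$ used to seek the unique minimizer $w^\star$ of $\min_{w\in\mathbb R^M}\sum_{k=1}^N q_kJ_k(w)$, with the network, step-sizes $\mu_k=(q_k/p_k)\mu_o$, risks $J_k$ and gradient noise satisfying all the assumptions listed in the context, with parameters $\{\eta_k,\beta_k^2,\sigma_k^2,e_k^2,f_k^2\}$. Then there exists a constant $h\ge 0$, not depending on the iteration index or on $\mu_o$, such that the following holds whenever the step-sizes are small enough that, for every $k=1,\dots,N$, $$0<\mu_k<\min\left\{\frac1{\eta_k},\ \frac{\eta_kq_k}{p_k\beta_k^2+(1+2h)p_ke_k^2}\right\}.$$ The constant $h$ is a bound on the asymptotic network disagreement: there is an $I_o$ such that $$\mathbb E\,\Big\|\sum_{\ell=1}^N p_\ell(w^\star-\boldsymbol{w}_{\ell,i-1})-(w^\star-\boldsymbol{w}_{k,i-1})\Big\|^2\le h^2\mu_o^2\qquad\text{for all } i\ge I_o \text{ and all } k.$$ Moreover, let $$\alpha=\max_{1\le k\le N}\left\{1-\mu_k\big(\eta_k-\mu_oe_k^2-\mu_o\beta_k^2-2\mu_oh\,e_k^2\big)\right\}\in(0,1),$$ and define the weighted iterates $$\bar{\boldsymbol{w}}_{k,L}=\sum_{j=0}^L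 r_L(j)\,\boldsymbol{w}_{k,j},\qquad r_L(j)=\frac{\alpha^{L-j}}{S_L},\qquad S_L=\sum_{j=0}^L\alpha^{L-j}.$$ Then $$\limsup_{L\to\infty}\ \mathbb E\Big(\sum_{k=1}^Nq_kJ_k(\bar{\boldsymbol{w}}_{k,L})-\sum_{k=1}^Nq_kJ_k(w^\star)\Big)\le\frac{\mu_o}{2}\sum_{k=1}^N\Big(q_kf_k^2+q_k\sigma_k^2+2hq_k\Big[f_k^2+\|g_k'(w^\star)\|^2+\frac12\Big]\Big)=O(\mu_o),$$ and the convergence occurs at the exponential rate $O(\alpha^L)$: there is a constant $C$ independent of $L$ such that, for all $L$, the expectation on the left is at most $C\alpha^L$ plus the bound on the right.
   Context: **Network.** There are $N$ agents. $\mathcal N_k$ is the neighborhood of agent $k$ (including $k$). $A=[a_{\ell k}]$ is an $N\times N$ left-stochastic matrix: entries are nonnegative, each column sums to one, and $a_{\ell k}=0$ if $\ell\notin\mathcal N_k$. The network is strongly connected: any two distinct agents are linked in both directions by paths with nonzero weights, and $a_{kk}>0$ for at least one $k$; hence $A$ is primitive. $p=(p_1,\dots,p_N)^{\mathsf T}$ is its Perron vector: $Ap=p$, $p_k>0$, $\sum_kp_k=1$. **Weights and step-sizes.** $q_k>0$, $\sum_{k}q_k=1$. The constant step-sizes are $\mu_k=(q_k/p_k)\mu_o$ with $\mu_o>0$, so that $\sum_k p_k\mu_k=\mu_o$. **Risks.** $J_k:\mathbb R^M\to\mathbb R$ is $J_k(w)=\mathbb E\,Q_k(w;\boldsymbol{x}_k)$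 for a convex loss $Q_k$ and random data $\boldsymbol{x}_k$. $J_k$ is possibly non-differentiable. $\partial J_k(w)$ denotes its set of subgradients at $w$, and $g_k(w)\in\partial J_k(w)$ denotes a (true) subgradient. Assumptions, for each $k$: 1. (Strong convexity) with $\eta_k>0$: $J_k(w_1)\ge J_k(w_2)+g_k(w_2)^{\mathsf T}(w_1-w_2)+\frac{\eta_k}{2}\|w_1-w_2\|^2$ for all $w_1,w_2$ (and any subgradient at $w_2$). 2. (Affine-Lipschitz subgradients) there are constants $e_k^2,f_k^2\ge0$ with $\|g_k(w_1)-g_k'(w_2)\|^2\le e_k^2\|w_1-w_2\|^2+f_k^2$ for all $w_1,w_2$ and any subgradients $g_k(w_1)\in\partial J_k(w_1)$, $g_k'(w_2)\in\partial J_k(w_2)$. (This is implied by $\|g_k(w_1)-g_k'(w_2)\|\le c_k\|w_1-w_2\|+d_k$ with $c_k,d_k\ge 0$.) **Gradient noise.** $\widehat g_k(\boldsymbol{w}_{k,i-1})$ is a random approximation of $g_k(\boldsymbol{w}_{k,i-1})$ computed from the data at time $i$, and $\boldsymbol{s}_{k,i}(\boldsymbol{w}_{k,i-1})=\widehat g_k(\boldsymbol{w}_{k,i-1})-g_k(\boldsymbol{w}_{k,i-1})$. With $\boldsymbol{\mathcal F}_{i-1}$ the filtration generated by all past iterates $\{\boldsymbol{w}_{k,j}: j\le i-1,\ 1\le k\le N\}$, $$\mathbb E[\boldsymbol{s}_{k,i}(\boldsymbol{w}_{k,i-1})\mid\boldsymbol{\mathcal F}_{i-1}]=0,\qquad \mathbb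 E[\|\boldsymbol{s}_{k,i}(\boldsymbol{w}_{k,i-1})\|^2\mid\boldsymbol{\mathcal F}_{i-1}]\le\beta_k^2\|w^\star-\boldsymbol{w}_{k,i-1}\|^2+\sigma_k^2$$ for constants $\beta_k^2,\sigma_k^2\ge0$. The noise processes are independent across agents. The initial iterates satisfy $\mathbb E\|\boldsymbol{w}_{k,0}-w^\star\|^2<\infty$. **Subgradients at $w^\star$.** $g_k'(w^\star)\in\partial J_k(w^\star)$, $k=1,\dots,N$, are subgradients chosen so that $\sum_kq_kg_k'(w^\star)=0$; these exist since $w^\star$ minimizes $\sum_kq_kJ_k$. $\|\cdot\|$ is the Euclidean norm. *)

(* Defs.v *)
From HB Require Import structures.
From mathcomp Require Export all_boot all_order all_algebra.
From mathcomp Require Export all_classical all_reals all_analysis.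
Export numFieldNormedType.Exports.

Set Implicit Arguments.
Unset Strict Implicit.
Unset Printing Implicit Defensive.

Import Order.TTheory GRing.Theory Num.Theory.

Local Open Scope classical_set_scope.
Local Open Scope ring_scope.

(* Vectors of R^M are rows.  The norm that mathcomp-analysis puts on matrices
   is the sup norm, so the Euclidean one has to be introduced. *)
Section Euclidean.
Context {R : realType} {M : nat}.
Implicit Types u v w : 'rV[R]_M.

Definition dotv u v : R := \sum_(j < M) u 0 j * v 0 j.

Definition l2norm u : R := Num.sqrt (dotv u u).

Definition subdifferential (J : 'rV[R]_M -> R) w : set 'rV[R]_M :=
  [set v | forall u, J w + dotv v (u - w) <= J u].

Definition unique_minimizer (F : 'rV[R]_M -> R) w : Prop :=
  (forall u, F w <= F u) /\ (forall u, (forall v, F u <= F v) -> u = w).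

Definition strongly_convex (eta : R) (J : 'rV[R]_M -> R) : Prop :=
  forall w1 w2 v, subdifferential J w2 v ->
    J w2 + dotv v (w1 - w2) + eta / 2 * l2norm (w1 - w2) ^+ 2 <= J w1.

(* The constants enter squared, so that e and f may have any sign. *)
Definition affine_lipschitz_subgradients (e f : R) (J : 'rV[R]_M -> R) : Prop :=
  forall w1 w2 v1 v2, subdifferential J w1 v1 -> subdifferential J w2 v2 ->
    l2norm (v1 - v2) ^+ 2 <= e ^+ 2 * l2norm (w1 - w2) ^+ 2 + f ^+ 2.

End Euclidean.

Section Network.
Context {R : realType} {N : nat}.
Implicit Types (A : 'M[R]_N) (p q : 'I_N -> R).

(* The entry A l k is the weight that agent k gives to agent l. *)
Definition left_stochastic A : Prop :=
  (forall l k, 0 <= A l k) /\ (forall k, \sum_l A l k = 1).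

Definition strongly_connected A : Prop :=
  (forall l k, l != k -> connect (fun a b => A a b != 0) l k) /\
  (exists k, 0 < A k k).

Definition perron_vector A p : Prop :=
  [/\ A *m \col_k p k = \col_k p k, forall k, 0 < p k & \sum_k p k = 1].

Definition step_size p q (mu_o : R) (k : 'I_N) : R := q k / p k * mu_o.

End Network.

Section Probability.
Context {R : realType} {d : measure_display} {T : measurableType d}.
Context (P : probability T R).

(* sigma-algebra generated by the real-valued maps f a with a in D *)
Definition sigma_generated (I : Type) (D : set I) (f : I -> T -> R) :
    set (set T) :=
  <<s \bigcup_(a in D) preimage_set_system [set: T] (f a) measurable >>.

Definition measurable_wrt (F : set (set T)) (Y : T -> R) : Prop :=
  forall B, measurable B -> F (Y @^-1` B).

Definition random_vector (M : nat) (Y : T -> 'rV[R]_M) : Prop :=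
  forall j, measurable_fun [set: T] (fun t => Y t 0 j).

Definition mean_square (M : nat) (Y : T -> 'rV[R]_M) : \bar R :=
  'E_P[fun t => l2norm (Y t) ^+ 2].

(* Y is a version of E[X | F]. *)
Definition cond_expectation (F : set (set T)) (X Y : T -> R) : Prop :=
  [/\ P.-integrable [set: T] (EFin \o X),
      P.-integrable [set: T] (EFin \o Y),
      measurable_wrt F Y &
      forall B, F B ->
        (\int[P]_(t in B) (X t)%:E = \int[P]_(t in B) (Y t)%:E)%E].

Definition independent_families (I : finType) (G : I -> set (set T)) : Prop :=
  forall (S : {set I}) (B : I -> set T),
    (forall k, k \in S -> G k (B k)) ->
    P (\bigcap_(k in [set` S]) B k) = (\prod_(k in S) P (B k))%E.

End Probability.

Section Risk.
Context {R : realType} {M : nat} {d dX : measure_display}.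
Context {T : measurableType d} (P : probability T R) {X : measurableType dX}.

Definition risk (Q : 'rV[R]_M -> X -> R) (x : {RV P >-> X}) (w : 'rV[R]_M) : R :=
  fine 'E_P[fun t => Q w (x t)].

Definition integrable_convex_loss (Q : 'rV[R]_M -> X -> R) (x : {RV P >-> X}) : Prop :=
  (forall xi, convex_function [set: convex_lmodType 'rV[R]_M] (Q ^~ xi)) /\
  (forall w, P.-integrable [set: T] (fun t => (Q w (x t))%:E)).

End Risk.

Section Diffusion.
Context {R : realType} {N M : nat} {T : Type}.

(* ghat l i w is the approximation of g_l(w) that agent l computes at a fixed
   point w from its data at time i; the recursion evaluates it at the (random)
   current iterate. *)
Variables (Nb : 'I_N -> {set 'I_N}) (A : 'M[R]_N) (mu : 'I_N -> R).
Variables (ghat : 'I_N -> nat -> 'rV[R]_M -> T -> 'rV[R]_M).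
Variable (w0 : 'I_N -> T -> 'rV[R]_M).

Definition adapt (i : nat) (w : 'I_N -> T -> 'rV[R]_M) (l : 'I_N) (t : T) :
    'rV[R]_M :=
  w l t - mu l *: ghat l i (w l t) t.

Definition combine (psi : 'I_N -> T -> 'rV[R]_M) (k : 'I_N) (t : T) :
    'rV[R]_M :=
  \sum_(l in Nb k) A l k *: psi l t.

Fixpoint diffusion (i : nat) : 'I_N -> T -> 'rV[R]_M :=
  if i is i'.+1 then combine (adapt i (diffusion i')) else w0.

End Diffusion.

Section Noise.
Context {R : realType} {N M : nat} {d : measure_display} {T : measurableType d}.
Context (P : probability T R).
Implicit Types (w : nat -> 'I_N -> T -> 'rV[R]_M).

Definition noise (g : 'I_N -> 'rV[R]_M -> 'rV[R]_M)
    (ghat : 'I_N -> nat -> 'rV[R]_M -> T -> 'rV[R]_M)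
    (k : 'I_N) (i : nat) (v : 'rV[R]_M) (t : T) : 'rV[R]_M :=
  ghat k i v t - g k v.

(* F_i, generated by the iterates up to time i of all the agents *)
Definition past w (i : nat) : set (set T) :=
  sigma_generated [set a : nat * 'I_N * 'I_M | (a.1.1 <= i)%N]
    (fun a t => w a.1.1 a.1.2 t 0 a.2).

(* The noise processes are the random fields (i, v) |-> s_{k,i}(v), i >= 1.
   Independence is required of these fields and not of the values that they
   take along the iterates: the latter are coupled through the network as soon
   as the noise depends on the state. *)
Definition independent_noise (s : 'I_N -> nat -> 'rV[R]_M -> T -> 'rV[R]_M) :
    Prop :=
  (forall k i v, (0 < i)%N -> random_vector (s k i v)) /\
  independent_families P (fun k =>
    sigma_generated [set a : nat * 'rV[R]_M * 'I_M | (0 < a.1.1)%N]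
      (fun a t => s k a.1.1 a.1.2 t 0 a.2)).

Definition noise_moments (s : 'I_N -> nat -> 'rV[R]_M -> T -> 'rV[R]_M)
    (beta sigma : 'I_N -> R) (wstar : 'rV[R]_M) w : Prop :=
  forall k i, (0 < i)%N ->
    let si := fun t => s k i (w i.-1 k t) t in
    (forall j, cond_expectation P (past w i.-1) (fun t => si t 0 j) (cst 0)) /\
    (exists2 V : T -> R,
       cond_expectation P (past w i.-1) (fun t => l2norm (si t) ^+ 2) V &
       {ae P, forall t, V t <= beta k ^+ 2 * l2norm (wstar - w i.-1 k t) ^+ 2
                               + sigma k ^+ 2}).

(* A non-Borel selection of subgradients could make g_k(w_{k,i-1}) depend on
   more than the past. *)
Definition adapted_subgradients (g : 'I_N -> 'rV[R]_M -> 'rV[R]_M) w : Prop :=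
  forall k i j, measurable_wrt (past w i) (fun t => g k (w i k t) 0 j).

End Noise.

Section Performance.
Context {R : realType} {N M : nat}.
Implicit Types (p q mu eta beta sigma e f : 'I_N -> R) (mu_o h : R).

(* Strong convexity and affine-Lipschitz subgradients force
   e k ^+ 2 >= eta k ^+ 2 when M > 0, so the denominator is then positive. *)
Definition small_step_sizes p q mu eta beta e h : Prop :=
  forall k, 0 < mu k <
    Num.min (1 / eta k)
      (eta k * q k / (p k * beta k ^+ 2 + (1 + 2 * h) * p k * e k ^+ 2)).

(* The default value 0 plays no role: under small_step_sizes all the terms are
   positive. *)
Definition rate mu eta beta e mu_o h : R :=
  \big[Num.max/0]_k
    (1 - mu k * (eta k - mu_o * e k ^+ 2 - mu_o * beta k ^+ 2
                 - 2 * mu_o * h * e k ^+ 2)).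

Definition weighted_iterate {T : Type} (alpha : R)
    (w : nat -> 'I_N -> T -> 'rV[R]_M) (k : 'I_N) (L : nat) (t : T) :
    'rV[R]_M :=
  let S := \sum_(j < L.+1) alpha ^+ (L - j) in
  \sum_(j < L.+1) (alpha ^+ (L - j) / S) *: w j k t.

Definition performance_bound q f sigma (gstar : 'I_N -> 'rV[R]_M) h mu_o : R :=
  mu_o / 2 * \sum_k (q k * f k ^+ 2 + q k * sigma k ^+ 2
    + 2 * h * q k * (f k ^+ 2 + l2norm (gstar k) ^+ 2 + 1 / 2)).

End Performance.

(* Main.v *)
From mathcomp Require Import ring lra measurable_realfun.
Require Import Defs.

(** The proof couples the mean-square error of the network mean with the
    disagreement between the agents.

    Write c for the weighted mean of the iterates with the Perron weights p.
    Since p is fixed by the combination matrix and p_k mu_k = q_k mu_o, the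
    combination step leaves c unchanged and c performs a stochastic subgradient
    step of size mu_o along the mean of the agents' subgradients with weights q
    ([centroid_step]).  The noise of the step is orthogonal to the past
    ([Ex_orthogonal]), and convexity bounds its power, and that of the averaged
    subgradient, by averages over the agents ([centroid_recursion]).  The only
    obstacle to the usual analysis of one subgradient method is that the agents
    evaluate their subgradients at their own iterates and not at c, so the
    disagreement between the agents has to be controlled.

    Disagreement.  The matrix is primitive, so a power of it contracts deviations
    from the mean ([doeblin]), and a sum of energies over one period is a
    quadratic function contracted by every step, up to the size of the injected
    subgradients, which is O(mu_o^2) as long as the mean-square error is
    bounded ([disagreement_contraction], [disagreement_recursion]).  Strong monotonicity
    of the subgradients gives a recursion for the mean-square error of c which
    contracts at rate 1 - O(mu_o) and is perturbed by the disagreement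
    ([stability_recursion]).  The two recursions together bound the mean-square
    error independently of mu_o, and then the disagreement by O(mu_o^2), once mu_o
    is below some threshold m ([coupled_recursions], [uniform_disagreement]).
    All constants are independent of mu_o.  The constant h is taken so large that
    h^2 mu_o^2 exceeds this bound and also that the step-size condition, which
    becomes more restrictive when h grows, forces mu_o <= m ([small_mu_o]);
    this uses that in positive dimension strong convexity bounds the Lipschitz
    constants from below ([sconvex_le_lipschitz]).

    Performance.  Once the disagreement is below h^2 mu_o^2, strong convexity
    between the iterates and the minimizer gives a descent inequality for the
    mean-square error of c, in which the expected excess risk is at most
    (alpha a_i - a_{i+1}) / (2 mu_o) plus the announced bound
    ([descent_recursion]).  Weighted by alpha^(L-i), these inequalities telescope;
    the finitely many initial steps to which the inequality does not apply
    contribute O(alpha^L) ([weighted_mean_le]).  Convexity moves the average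
    inside the risks ([risk_jensen]), and the bound on the upper limit follows. *)

Set Implicit Arguments.
Unset Strict Implicit.
Unset Printing Implicit Defensive.

Import Order.TTheory GRing.Theory Num.Theory.

Local Open Scope classical_set_scope.
Local Open Scope ring_scope.

(** * Squared Euclidean norms *)

Local Notation sq u := (dotv u u).

Section InnerProduct.
Context {R : realType} {M : nat}.
Implicit Types (u v w : 'rV[R]_M) (a c : R).

Lemma dotvC u v : dotv u v = dotv v u.
Proof. by apply: eq_bigr => j _; rewrite mulrC. Qed.

Lemma dotvDl u v w : dotv (u + v) w = dotv u w + dotv v w.
Proof. by rewrite -big_split; apply: eq_bigr => j _; rewrite mxE mulrDl. Qed.

Lemma dotvDr u v w : dotv u (v + w) = dotv u v + dotv u w.
Proof. by rewrite dotvC dotvDl !(dotvC u). Qed.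

Lemma dotvZl a u v : dotv (a *: u) v = a * dotv u v.
Proof. by rewrite mulr_sumr; apply: eq_bigr => j _; rewrite mxE mulrA. Qed.

Lemma dotvZr a u v : dotv u (a *: v) = a * dotv u v.
Proof. by rewrite dotvC dotvZl dotvC. Qed.

Lemma dotvNl u v : dotv (- u) v = - dotv u v.
Proof. by rewrite -scaleN1r dotvZl mulN1r. Qed.

Lemma dotvNr u v : dotv u (- v) = - dotv u v.
Proof. by rewrite dotvC dotvNl dotvC. Qed.

Definition dotvE := (dotvDl, dotvDr, dotvNl, dotvNr, dotvZl, dotvZr).

Lemma dotv0l v : dotv 0 v = 0.
Proof. by rewrite -(scale0r (0 : 'rV_M)) dotvZl mul0r. Qed.

Lemma dotv_suml (I : finType) (F : I -> 'rV[R]_M) v :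
  dotv (\sum_i F i) v = \sum_i dotv (F i) v.
Proof.
apply: (big_ind2 (fun x y => dotv x v = y)) => //; first exact: dotv0l.
by move=> x1 y1 x2 y2 <- <-; rewrite dotvDl.
Qed.

Lemma sq_ge0 u : 0 <= sq u.
Proof. by apply: sumr_ge0 => j _; rewrite -expr2 sqr_ge0. Qed.

Lemma l2norm_sq u : l2norm u ^+ 2 = sq u.
Proof. by rewrite sqr_sqrtr // sq_ge0. Qed.

Lemma sqN u : sq (- u) = sq u.
Proof. by rewrite !dotvE opprK. Qed.

Lemma sqBC u v : sq (u - v) = sq (v - u).
Proof. by rewrite -sqN opprB. Qed.

Lemma sqZ a u : sq (a *: u) = a ^+ 2 * sq u.
Proof. by rewrite !dotvE mulrA. Qed.

Lemma sqD u v : sq (u + v) = sq u + 2 * dotv u v + sq v.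
Proof. rewrite !dotvE (dotvC v u); ring. Qed.

Lemma young c u v : 0 < c -> 2 * dotv u v <= c * sq u + c^-1 * sq v.
Proof.
move=> c0; have := sq_ge0 (c *: u - v); rewrite sqD sqN sqZ dotvNr dotvZl => h.
rewrite -(ler_pM2l c0) mulrDr mulVKf ?gt_eqF//; nra.
Qed.

Lemma sqD_le c u v :
  0 < c -> sq (u + v) <= (1 + c) * sq u + (1 + c^-1) * sq v.
Proof. by move=> c0; have := young u v c0; rewrite sqD; nra. Qed.

Lemma sqD_le2 u v : sq (u + v) <= 2 * sq u + 2 * sq v.
Proof. by have := sqD_le u v (@ltr01 R); rewrite invr1. Qed.

(** The variance identity; Jensen's inequality for the squared norm is the
    nonnegativity of its left-hand side. *)
Lemma variance (I : finType) (r : I -> R) (F : I -> 'rV[R]_M) :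
  \sum_i r i = 1 ->
  \sum_i r i * sq (F i - \sum_j r j *: F j)
    = \sum_i r i * sq (F i) - sq (\sum_j r j *: F j).
Proof.
move=> r1; set m := \sum_j _ *: _.
have -> : \sum_i r i * sq (F i - m) =
          \sum_i (r i * sq (F i) - 2 * dotv (r i *: F i) m + r i * sq m).
  by apply: eq_bigr => i _; rewrite sqD sqN dotvNr dotvZl; ring.
rewrite big_split sumrB /= -mulr_suml r1 -mulr_sumr -dotv_suml -/m; ring.
Qed.

Lemma sq_jensen (I : finType) (r : I -> R) (F : I -> 'rV[R]_M) :
  (forall i, 0 <= r i) -> \sum_i r i = 1 ->
  sq (\sum_i r i *: F i) <= \sum_i r i * sq (F i).
Proof.
move=> r0 r1; rewrite -subr_ge0 -(variance _ r1).
by apply: sumr_ge0 => i _; rewrite mulr_ge0 // sq_ge0.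
Qed.

End InnerProduct.

(** * Mixing and disagreement in the network *)

Lemma finite_pos_lower_bound (R : realType) (I : finType) (F : I -> R) :
  (forall i, 0 < F i) -> exists2 c : R, 0 < c <= 1 & forall i, c <= F i.
Proof.
move=> F0; have s0 : 0 <= \sum_i (F i)^-1.
  by apply: sumr_ge0 => i _; rewrite invr_ge0 ltW.
exists (1 + \sum_i (F i)^-1)^-1 => [|i].
  by rewrite invr_gt0 invf_le1 ?lerDl; [rewrite s0 andbT|]; lra.
rewrite invf_ple ?posrE //; last lra.
rewrite (bigD1 i) //= addrCA lerDl addr_ge0 //.
by apply: sumr_ge0 => j _; rewrite invr_ge0 ltW.
Qed.

Section Mixing.
Context {R : realType} {N M : nat}.
Variables (A : 'M[R]_N) (p : 'I_N -> R).
Implicit Types (u v : 'I_N -> 'rV[R]_M) (k l : 'I_N).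

Definition mix u k : 'rV[R]_M := \sum_l A l k *: u l.

Definition centroid u : 'rV[R]_M := \sum_l p l *: u l.

Definition spread u k : 'rV[R]_M := u k - centroid u.

Definition energy u : R := \sum_k p k * sq (u k).

Hypothesis A_stoch : left_stochastic A.
Hypothesis A_perron : perron_vector A p.

Let p_gt0 k : 0 < p k. Proof. by case: A_perron. Qed.
Let p_sum : \sum_k p k = 1. Proof. by case: A_perron. Qed.

Lemma weight_le1 k : p k <= 1.
Proof.
rewrite -p_sum (bigD1 k) //= lerDl.
by apply: sumr_ge0 => l _; rewrite ltW.
Qed.

Lemma perron_sum l : \sum_k A l k * p k = p l.
Proof.
case: A_perron => /matrixP/(_ l 0) + _ _; rewrite !mxE => <-.
by apply: eq_bigr => k _; rewrite mxE.
Qed.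

Lemma energy_ge0 u : 0 <= energy u.
Proof. by apply: sumr_ge0 => k _; rewrite mulr_ge0 ?sq_ge0 // ltW. Qed.

Lemma sq_le_energy u k : p k * sq (u k) <= energy u.
Proof.
rewrite /energy (bigD1 k) //= lerDl.
by apply: sumr_ge0 => l _; rewrite mulr_ge0 ?sq_ge0 // ltW.
Qed.

Lemma energy_spread u : energy (spread u) = energy u - sq (centroid u).
Proof. exact: variance. Qed.

Lemma energyD_le c u v : 0 < c ->
  energy (fun k => u k + v k) <= (1 + c) * energy u + (1 + c^-1) * energy v.
Proof.
move=> c0; rewrite !mulr_sumr -big_split /=; apply: ler_sum => k _.
rewrite !(mulrCA _ (p k)) -mulrDr ler_wpM2l ?sqD_le //.
by rewrite ltW.
Qed.

Lemma centroidB u v : centroid (fun k => u k - v k) = centroid u - centroid v.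
Proof. by rewrite /centroid -sumrB; apply: eq_bigr => k _; rewrite scalerBr. Qed.

Lemma mixB u v : mix (fun k => u k - v k) = fun k => mix u k - mix v k.
Proof.
apply/funext => k; rewrite /mix -sumrB.
by apply: eq_bigr => l _; rewrite scalerBr.
Qed.

Lemma spreadB u v :
  spread (fun k => u k - v k) = fun k => spread u k - spread v k.
Proof. by apply/funext => k; rewrite /spread centroidB !opprD addrACA. Qed.

Lemma centroid_mix u : centroid (mix u) = centroid u.
Proof.
rewrite /centroid /mix.
under eq_bigr do rewrite scaler_sumr.
rewrite exchange_big /=; apply: eq_bigr => l _.
under eq_bigr do rewrite scalerA mulrC.
by rewrite -scaler_suml perron_sum.
Qed.

Lemma spread_mix u : spread (mix u) = mix (spread u).
Proof.
apply/funext => k; rewrite /spread centroid_mix.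
rewrite /mix; under [RHS]eq_bigr do rewrite scalerBr.
by rewrite sumrB -scaler_suml A_stoch.2 scale1r.
Qed.

Lemma centroid_spread u : centroid (spread u) = 0.
Proof.
rewrite /centroid; under eq_bigr do rewrite scalerBr.
by rewrite sumrB -scaler_suml p_sum scale1r subrr.
Qed.

Lemma energy_mix u : energy (mix u) <= energy u.
Proof.
apply: (@le_trans _ _ (\sum_k p k * \sum_l A l k * sq (u l))).
  apply: ler_sum => k _; rewrite ler_wpM2l ?(ltW (p_gt0 _)) //.
  by apply: sq_jensen => [l|]; [apply: A_stoch.1|apply: A_stoch.2].
under eq_bigr do rewrite mulr_sumr.
rewrite exchange_big /= le_eqVlt; apply/orP; left; apply/eqP.
apply: eq_bigr => l _; rewrite -perron_sum mulr_suml.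
by apply: eq_bigr => k _; ring.
Qed.

Lemma iter_mixE n u k : iter n mix u k = \sum_l (A ^+ n) l k *: u l.
Proof.
elim: n k => [|n IHn] k /=.
  rewrite expr0 (bigD1 k) //= big1 => [|l lk]; last first.
    by rewrite mxE (negbTE lk) scale0r.
  by rewrite mxE eqxx scale1r addr0.
transitivity (\sum_m A m k *: iter n mix u m) => [//|].
under [LHS]eq_bigr do rewrite IHn scaler_sumr.
rewrite exchange_big /=; apply: eq_bigr => l _.
rewrite exprSr -mulmxE mxE scaler_suml; apply: eq_bigr => m _.
by rewrite scalerA mulrC.
Qed.

Lemma iter_mix_energy n u : energy (iter n mix u) <= energy u.
Proof. by elim: n => // n IHn /=; exact: le_trans (energy_mix _) IHn. Qed.

Lemma expmx_ge0 n l k : 0 <= (A ^+ n) l k.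
Proof.
elim: n l k => [|n IHn] l k; first by rewrite mxE; case: eqP.
rewrite exprS -mulmxE mxE; apply: sumr_ge0 => m _.
by rewrite mulr_ge0 // A_stoch.1.
Qed.

Lemma expmx_gt0D m n l j k :
  0 < (A ^+ m) l j -> 0 < (A ^+ n) j k -> 0 < (A ^+ (m + n)) l k.
Proof.
move=> lj jk; rewrite exprD -mulmxE mxE (bigD1 j) //=.
by rewrite ltr_pwDl ?mulr_gt0 // sumr_ge0 // => i _; rewrite mulr_ge0 ?expmx_ge0.
Qed.

Lemma expmx_stoch n k : \sum_l (A ^+ n) l k = 1.
Proof.
elim: n k => [|n IHn] k.
  rewrite expr0 (bigD1 k) //= big1 => [|l lk]; last by rewrite mxE (negbTE lk).
  by rewrite mxE eqxx addr0.
under eq_bigr do rewrite exprS -mulmxE mxE.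
rewrite exchange_big /=; under eq_bigr do rewrite -mulr_suml A_stoch.2 mul1r.
exact: IHn.
Qed.

Lemma expmx_perron n l : \sum_k (A ^+ n) l k * p k = p l.
Proof.
elim: n l => [|n IHn] l.
  rewrite expr0 (bigD1 l) //= big1 => [|k kl]; last first.
    by rewrite mxE eq_sym (negbTE kl) mul0r.
  by rewrite mxE eqxx mul1r addr0.
under eq_bigr do rewrite exprSr -mulmxE mxE mulr_suml.
rewrite exchange_big /= -[RHS]IHn; apply: eq_bigr => m _.
by rewrite -[in RHS]perron_sum mulr_sumr; apply: eq_bigr => k _; rewrite mulrA.
Qed.

Hypothesis A_conn : strongly_connected A.

(** Strong connectivity and one self-loop make the matrix primitive: a walk
    from l to k can be routed through the self-loop, where it waits until its
    length reaches a value common to all pairs. *)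
Lemma primitive : exists n, forall l k, 0 < (A ^+ n) l k.
Proof.
have walk l k : exists n, 0 < (A ^+ n) l k.
  have [->|lk] := eqVneq l k.
    by exists 0%N; rewrite expr0 mxE eqxx ltr01.
  have /connectP[s] := A_conn.1 _ _ lk; elim: s l {lk} => [|m s IHs] l /=.
    by move=> _ ->; exists 0%N; rewrite expr0 mxE eqxx ltr01.
  move=> /andP[lm /IHs{}IHs] /IHs[n mk]; exists (1 + n)%N.
  by apply: expmx_gt0D mk; rewrite expr1 lt_neqAle eq_sym lm A_stoch.1.
case: A_conn => _ [k0 loop].
have wait n : 0 < (A ^+ n) k0 k0.
  elim: n => [|n IHn]; first by rewrite expr0 mxE eqxx ltr01.
  by rewrite -add1n; apply: expmx_gt0D IHn; rewrite expr1.
have /choice[a aP] : forall l, exists n, 0 < (A ^+ n) l k0 by move=> l.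
have /choice[b bP] : forall k, exists n, 0 < (A ^+ n) k0 k by move=> k.
exists (\max_l a l + \max_k b k)%N => l k.
have al : (a l <= \max_l a l)%N by exact: leq_bigmax.
have bk : (b k <= \max_k b k)%N by exact: leq_bigmax.
rewrite -{}(subnKC al) -{}(subnK bk) addnA -(addnA (a l)).
exact: expmx_gt0D (expmx_gt0D (aP l) (wait _)) (bP k).
Qed.

(** Doeblin's argument: a positive power of A dominates a multiple of the
    rank-one matrix with columns p, which annihilates centred families; what is
    left of the power is a scaled averaging operator. *)
Lemma doeblin : exists n, exists2 r : R, 0 < r < 1 &
  forall u, centroid u = 0 -> energy (iter n mix u) <= r * energy u.
Proof.
have [n An] := primitive.
have [c /andP[c0 c1] cP] :=
  @finite_pos_lower_bound R _ (fun a : 'I_N * 'I_N => (A ^+ n) a.1 a.2)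
    (fun a => An a.1 a.2).
(* half of c, so that the remaining factor s is positive even when c = 1 *)
pose s : R := 1 - c / 2; exists n, s => [|u u0]; first by rewrite /s; lra.
have s0 : 0 < s by rewrite /s; lra.
pose B l k := ((A ^+ n) l k - c / 2 * p l) / s.
have B0 l k : 0 <= B l k.
  rewrite divr_ge0 ?(ltW s0) // subr_ge0.
  have := cP (l, k); have := weight_le1 l; have := p_gt0 l => /=; nra.
have B1 k : \sum_l B l k = 1.
  by rewrite -mulr_suml sumrB expmx_stoch -mulr_sumr p_sum mulr1 divff ?gt_eqF.
have Bp l : \sum_k p k * B l k = p l.
  have -> : \sum_k p k * B l k =
     (\sum_k (A ^+ n) l k * p k - (\sum_k p k) * (c / 2 * p l)) / s.
    by rewrite mulr_suml -sumrB mulr_suml; apply: eq_bigr => k _; rewrite /B; ring.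
  by rewrite expmx_perron p_sum /s; field; rewrite gt_eqF //; lra.
have Eu k : iter n mix u k = s *: \sum_l B l k *: u l.
  have cu : \sum_l c / 2 *: (p l *: u l) = 0.
    by rewrite -scaler_sumr [X in _ *: X]u0 scaler0.
  transitivity (\sum_l (A ^+ n) l k *: u l - \sum_l c / 2 *: (p l *: u l)).
    by rewrite cu subr0 iter_mixE.
  rewrite scaler_sumr.
  rewrite -sumrB; apply: eq_bigr => l _; rewrite !scalerA -scalerBl /B.
  by rewrite [s * _]mulrC divfK ?gt_eqF.
rewrite /energy; under eq_bigr do rewrite Eu sqZ.
apply: (@le_trans _ _ (s ^+ 2 * \sum_k p k * \sum_l B l k * sq (u l))).
  rewrite mulr_sumr; apply: ler_sum => k _.
  by rewrite mulrCA ler_pM2l ?exprn_gt0 // ler_wpM2l ?(ltW (p_gt0 _)) ?sq_jensen.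
have -> : \sum_k p k * \sum_l B l k * sq (u l) = energy u.
  under eq_bigr do rewrite mulr_sumr.
  rewrite exchange_big /=; apply: eq_bigr => l _; rewrite -[in RHS]Bp mulr_suml.
  by apply: eq_bigr => k _; rewrite mulrA.
rewrite ler_wpM2r ?energy_ge0 // expr2 -[leRHS]mul1r ler_wpM2r ?(ltW s0) //.
by rewrite /s; lra.
Qed.

(** Mixing need not contract the spread in a single step.  Adding up the spread
    energies over a full period of n steps gives a quadratic function which it
    does contract at every step. *)
Definition lyapunov n u : R := \sum_(m < n) energy (iter m mix (spread u)).

Lemma lyapunov_ge0 n u : 0 <= lyapunov n u.
Proof. by apply: sumr_ge0 => m _; exact: energy_ge0. Qed.

Lemma energy_spread_le_lyapunov n u :
  energy (spread u) <= lyapunov n.+1 u.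
Proof.
rewrite /lyapunov big_ord_recl /= lerDl.
by apply: sumr_ge0 => m _; exact: energy_ge0.
Qed.

Lemma lyapunov_le n u : lyapunov n u <= n%:R * energy (spread u).
Proof.
rewrite mulr_natl -[in leRHS](card_ord n) -sumr_const.
by apply: ler_sum => m _; exact: iter_mix_energy.
Qed.

Lemma iter_mixB n u v :
  iter n mix (fun k => u k - v k) = fun k => iter n mix u k - iter n mix v k.
Proof. by elim: n => //= n ->; rewrite mixB. Qed.

Lemma lyapunovB_le n c u v : 0 < c ->
  lyapunov n (fun k => u k - v k)
    <= (1 + c) * lyapunov n u + (1 + c^-1) * lyapunov n v.
Proof.
move=> c0; rewrite !mulr_sumr -big_split /=; apply: ler_sum => m _.
rewrite spreadB iter_mixB.
apply: le_trans (energyD_le _ _ c0) _; rewrite lerD2l; apply: ler_wpM2l.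
  by rewrite addr_ge0 // invr_ge0 ltW.
by rewrite /energy; under eq_bigr do rewrite sqN.
Qed.

(** The contraction has room for the factor 1 + c of Young's inequality, which
    separates the state u from the increment v. *)
Lemma disagreement_contraction : exists n, exists r K : R,
  [/\ 0 <= r < 1, 0 <= K & forall u v,
    lyapunov n.+1 (mix (fun k => u k - v k))
      <= r * lyapunov n.+1 u + K * energy v].
Proof.
have [n0 [s /andP[s0 s1] sP]] := doeblin.
have [n [{}s0 {}sP]] : exists n, (0:R) < s /\ forall u, centroid u = 0 ->
    energy (iter n.+1 mix u) <= s * energy u.
  exists n0; split=> // u u0 /=; apply: le_trans (energy_mix _) (sP u u0).
pose t : R := 1 - (1 - s) / n.+1%:R.
have n0' : 0 < n.+1%:R :> R by rewrite ltr0n.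
have t1 : t < 1 by rewrite /t ltrBlDr ltrDl divr_gt0 // subr_gt0.
have t0 : 0 < t.
  rewrite /t subr_gt0 ltr_pdivrMr // mul1r.
  by apply: lt_le_trans (_ : 1 <= _); [lra|rewrite ler1n].
have contr u : lyapunov n.+1 (mix u) <= t * lyapunov n.+1 u.
  have -> : lyapunov n.+1 (mix u) =
    lyapunov n.+1 u - energy (spread u) + energy (iter n.+1 mix (spread u)).
    rewrite /lyapunov big_ord_recr [in RHS]big_ord_recl /= spread_mix.
    rewrite (addrC (energy (spread u))) addrK.
    by congr (_ + _); [apply: eq_bigr => m _|]; rewrite -iterSr.
  have h := lyapunov_le n.+1 u; rewrite -ler_pdivrMl // in h.
  have e := sP _ (centroid_spread u).
  have : (1 - s) * (n.+1%:R^-1 * lyapunov n.+1 u) <= (1 - s) * energy (spread u).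
    by rewrite ler_wpM2l // subr_ge0 ltW.
  rewrite /t [(1 - _ / _) * _]mulrBl mul1r -mulrA.
  rewrite [(1 - s) * energy _]mulrBl mul1r.
  by move: (energy _) (energy _) ((1 - s) * _) (s * energy _) e => *; lra.
(* c is chosen so that t (1 + c) = (1 + t) / 2 *)
pose c : R := (1 - t) / (2 * t).
have c0 : 0 < c by rewrite divr_gt0 // ?subr_gt0 // mulr_gt0.
have ci0 : 0 <= 1 + c^-1 by rewrite addr_ge0 // invr_ge0 ltW.
exists n, ((1 + t) / 2), (t * (1 + c^-1) * n.+1%:R); split; first lra.
  by rewrite !mulr_ge0 // ltW.
move=> u v; apply: le_trans (contr _) _.
apply: le_trans (ler_wpM2l (ltW t0) (lyapunovB_le n.+1 u v c0)) _.
rewrite mulrDr !mulrA; apply: lerD.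
  by rewrite ler_wpM2r ?lyapunov_ge0 // /c le_eqVlt; apply/orP; left; apply/eqP;
     field; rewrite gt_eqF.
rewrite -!mulrA ler_wpM2l ?(ltW t0) // ler_wpM2l //.
apply: le_trans (lyapunov_le _ _) _; rewrite ler_wpM2l ?(ltW n0') //.
by rewrite energy_spread gerBl sq_ge0.
Qed.

End Mixing.

(** * Scalar recursions *)

Section Recursions.
Context {R : realType}.
Implicit Types (b c r mu kappa K : R) (a x y v : R^nat).

Lemma eventually_le_of_contraction y r b c I :
  0 <= r < 1 -> 0 < c ->
  (forall i, (I <= i)%N -> y i.+1 <= r * y i + b) ->
  exists I', forall i, (I' <= i)%N -> y i <= b / (1 - r) + c.
Proof.
move=> /andP[r0 r1] c0 yP; set z := b / (1 - r).
have zE : r * z + b = z by rewrite /z; field; rewrite subr_eq0 gt_eqF.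
have geo i : y (I + i)%N - z <= `|y I - z| * r ^+ i.
  elim: i => [|i IHi]; first by rewrite addn0 expr0 mulr1 ler_norm.
  rewrite addnS exprSr; have := yP (I + i)%N (leq_addr _ _).
  have := ler_wpM2l r0 IHi; rewrite (mulrCA r) (mulrC r (r ^+ i)); lra.
have := @cvg_geometric R `|y I - z| r; rewrite ger0_norm // => /(_ r1).
move=> /cvgrPdist_lt/(_ c c0)[n _ nP].
exists (I + n)%N => i ni; rewrite -(subnKC (leq_trans (leq_addr _ _) ni)).
have /nP : (n <= i - I)%N by rewrite leq_subRL // (leq_trans _ ni) // leq_addr.
rewrite /= sub0r normrN ger0_norm ?mulr_ge0 ?exprn_ge0 //.
have := geo (i - I)%N; rewrite /geometric /=; lra.
Qed.

(** The mean-square error a of the centroid contracts at a rate 1 - O(mu),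
    the disagreement v at a rate r independent of mu, and each drives the other.
    For small mu the sum a + v contracts at a rate 1 - O(mu) up to O(mu), so it
    is eventually bounded independently of mu; fed back into the second
    recursion, this makes v eventually O(mu^2). *)
Lemma coupled_recursions kappa r K :
  0 < kappa -> 0 <= r < 1 -> 0 <= K ->
  exists m D, [/\ 0 < m, 0 <= D & forall mu a v, 0 < mu <= m ->
    (forall i, 0 <= a i) -> (forall i, 0 <= v i) ->
    (forall i, a i.+1 <= (1 - mu * kappa) * a i + mu * K * (1 + v i)
                         + mu ^+ 2 * K * (a i + v i + 1)) ->
    (forall i, v i.+1 <= r * v i + mu ^+ 2 * K * (a i + v i + 1)) ->
    exists I, forall i, (I <= i)%N -> v i <= D * mu ^+ 2].
Proof.
move=> kappa0 /andP[r0 r1] K0.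
have d1 : 0 < 4 * K + kappa by lra.
have d2 : 0 < 3 * K + kappa by lra.
(* mu <= m1 keeps the second-order terms within half of the drift of a, and
   mu <= m2 keeps the factor in front of v at most 1 - mu * kappa / 2 *)
pose m1 := kappa / (4 * K + kappa); pose m2 := (1 - r) / (3 * K + kappa).
pose B := 6 * K / kappa + 1.
have B0 : 0 <= B by rewrite addr_ge0 // divr_ge0 ?(ltW kappa0) // mulr_ge0.
exists (Num.min m1 m2), (K * (B + 1) / (1 - r) + 1); split.
- by rewrite lt_min !divr_gt0 // subr_gt0.
- by rewrite addr_ge0 // divr_ge0 ?subr_ge0 ?(ltW r1) // mulr_ge0 // addr_ge0.
move=> mu a v /andP[mu0]; rewrite le_min => /andP[].
rewrite /m1 ler_pdivlMr // => h1; rewrite /m2 ler_pdivlMr // => h2 a0 v0 aP vP.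
have mu1 : mu <= 1.
  by rewrite -(ler_pM2r d1); apply: le_trans h1 _; lra.
have muK : 0 <= mu * K by rewrite mulr_ge0 // ltW.
have mumuK : mu * (mu * K) <= mu * K by rewrite ler_piMl.
pose s := 1 - mu * (kappa / 2).
have sr : r <= s by rewrite /s; nra.
have s01 : 0 <= s < 1.
  by rewrite (le_trans r0 sr) /= /s; have := mulr_gt0 mu0 kappa0; lra.
have yP i : (0 <= i)%N -> a i.+1 + v i.+1 <= s * (a i + v i) + 3 * (mu * K).
  move=> _; have := aP i; have := vP i; rewrite expr2 -(mulrA mu mu K) => hv ha.
  have ha' : (2 * (mu * (mu * K))) * a i <= (mu * (kappa / 2)) * a i.
    by rewrite ler_wpM2r //; have := ler_wpM2l (ltW mu0) h1; nra.
  have hv' : (r + mu * K + 2 * (mu * (mu * K))) * v i <= s * v i.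
    by rewrite ler_wpM2r // /s; nra.
  rewrite /s in hv' *; nra.
have [I IP] := eventually_le_of_contraction s01 ltr01 yP.
have BE : 3 * (mu * K) / (1 - s) + 1 = B.
  have -> : 1 - s = mu * (kappa / 2) by rewrite /s; ring.
  by rewrite /B; field; rewrite (gt_eqF kappa0) (gt_eqF mu0).
have mumu0 : 0 < mu ^+ 2 by rewrite exprn_gt0.
have vP' i : (I <= i)%N -> v i.+1 <= r * v i + mu ^+ 2 * K * (B + 1).
  move=> /IP; rewrite BE => yB; apply: le_trans (vP i) _.
  by rewrite lerD2l ler_wpM2l ?lerD2r // mulr_ge0 // ltW.
have r01 : 0 <= r < 1 by rewrite r0.
have [I' I'P] := eventually_le_of_contraction r01 mumu0 vP'.
exists I' => i /I'P /le_trans; apply; rewrite le_eqVlt; apply/orP; left.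
by apply/eqP; field; rewrite subr_eq0 gt_eqF.
Qed.

Lemma weighted_sumS r (x : R^nat) L :
  \sum_(j < L.+2) r ^+ (L.+1 - j) * x j
    = r * \sum_(j < L.+1) r ^+ (L - j) * x j + x L.+1.
Proof.
rewrite big_ord_recr /= subnn expr0 mul1r mulr_sumr; congr (_ + _).
by apply: eq_bigr => j _; rewrite subSn ?exprS ?mulrA // -ltnS.
Qed.

(** The terms before I enter the weighted mean with weights O(r^L), which is why
    a descent inequality that only holds eventually still gives the rate r^L. *)
Lemma weighted_mean_le r b (a x : R^nat) I : 0 < r < 1 ->
  (forall j, 0 <= a j) ->
  (forall j, (I <= j)%N -> x j <= r * a j - a j.+1 + b) ->
  exists C, forall L,
    \sum_(j < L.+1) r ^+ (L - j) / (\sum_(m < L.+1) r ^+ (L - m)) * x j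
      <= C * r ^+ L + b.
Proof.
move=> /andP[r0 r1] a0 xP.
(* the violation of the descent inequality, which vanishes from I on *)
pose D j := Num.max 0 (x j - (r * a j - a j.+1 + b)).
have D0 j : 0 <= D j by rewrite /D le_max lexx.
have xD j : x j <= r * a j - a j.+1 + b + D j.
  by rewrite addrC -lerBlDr /D le_max lexx orbT.
have DI j : (I <= j)%N -> D j = 0.
  by move=> /xP h; apply/max_idPl; rewrite subr_le0.
pose E n := \sum_(j < n) r ^- j * D j.
have rD j : 0 <= r ^- j * D j.
  by rewrite mulr_ge0 // invr_ge0 exprn_ge0 // ltW.
have EI n : E n <= E I.
  have [nI|In] := leqP n I.
    by rewrite /E -(subnKC nI) big_split_ord /= lerDl sumr_ge0.
  rewrite /E -(subnKC (ltnW In)) big_split_ord /= gerDl big1 // => j _.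
  by rewrite DI ?mulr0 // leq_addr.
pose S L := \sum_(m < L.+1) r ^+ (L - m).
have S1 L : 1 <= S L.
  by rewrite /S big_ord_recr /= subnn lerDr sumr_ge0 // => j _;
     rewrite exprn_ge0 // ltW.
have tele L : \sum_(j < L.+1) r ^+ (L - j) * x j
    <= r ^+ L * (r * a 0%N + E L.+1) - a L.+1 + S L * b.
  elim: L => [|L IHL].
    rewrite /E /S !big_ord_recl !big_ord0 /= !expr0 invr1 !mul1r !addr0.
    by have := xD 0%N; lra.
  have -> : S L.+1 = r * S L + 1.
    have := weighted_sumS r (fun=> 1) L; rewrite /S.
    by under eq_bigr do rewrite mulr1; under [in RHS]eq_bigr do rewrite mulr1.
  have -> : E L.+2 = E L.+1 + r ^- L.+1 * D L.+1 by rewrite /E big_ord_recr.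
  rewrite weighted_sumS; have := ler_wpM2l (ltW r0) IHL.
  have -> : r ^+ L.+1 * (r * a 0%N + (E L.+1 + r ^- L.+1 * D L.+1))
      = r * (r ^+ L * (r * a 0%N + E L.+1)) + D L.+1.
    rewrite addrA mulrDr [_ * (r ^- _ * _)]mulrA divff ?expf_neq0 ?gt_eqF //.
    by rewrite mul1r exprS mulrA.
  by have := xD L.+1; nra.
exists (r * a 0%N + E I) => L.
have SL : 0 < S L by apply: lt_le_trans (S1 L).
have -> : \sum_(j < L.+1) r ^+ (L - j) / (\sum_(m < L.+1) r ^+ (L - m)) * x j
    = (\sum_(j < L.+1) r ^+ (L - j) * x j) / S L.
  by rewrite mulr_suml; apply: eq_bigr => j _; rewrite mulrAC.
rewrite ler_pdivrMr //; apply: le_trans (tele L) _.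
have rL : 0 <= r ^+ L by rewrite exprn_ge0 // ltW.
have E0 : 0 <= E I by rewrite sumr_ge0.
have c0 : 0 <= (r * a 0%N + E I) * r ^+ L.
  by rewrite mulr_ge0 // addr_ge0 // mulr_ge0 // ltW.
have := ler_peMr c0 (S1 L); have := a0 L.+1.
have : r ^+ L * (r * a 0%N + E L.+1) <= (r * a 0%N + E I) * r ^+ L.
  by rewrite mulrC ler_wpM2r // lerD2l.
move=> h1 h2 h3; rewrite [leRHS]mulrDl (mulrC b); lra.
Qed.

End Recursions.

(** * Integrable and square-integrable random variables *)

Section Moments.
Context {R : realType} {d : measure_display} {T : measurableType d}.
Variable P : probability T R.
Implicit Types (X Y Z : T -> R) (c : R).

Definition L1 X : Prop := P.-integrable [set: T] (EFin \o X).

Definition L2 X : Prop :=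
  measurable_fun [set: T] X /\ L1 (fun t => X t ^+ 2).

Definition Ex X : R := \int[P]_t X t.

Lemma expectation_Ex X : L1 X -> ('E_P[X] = (Ex X)%:E)%E.
Proof. by move=> iX; rewrite unlock fineK // integrable_fin_num. Qed.

Lemma L1_meas X : L1 X -> measurable_fun [set: T] X.
Proof. by move=> /measurable_int /measurable_EFinP. Qed.

Lemma L1_le X Y : measurable_fun [set: T] X -> (forall t, `|X t| <= Y t) ->
  L1 Y -> L1 X.
Proof.
move=> mX XY; apply: le_integrable => //; first exact/measurable_EFinP.
by move=> t _ /=; rewrite lee_fin (le_trans (XY t)) // ler_norm.
Qed.

Lemma L1_cst c : L1 (fun=> c).
Proof. exact: finite_measure_integrable_cst. Qed.

Lemma L1D X Y : L1 X -> L1 Y -> L1 (fun t => X t + Y t).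
Proof. by move=> iX iY; apply: (integrableD _ iX iY). Qed.

Lemma L1Z c X : L1 X -> L1 (fun t => c * X t).
Proof. by move=> iX; apply: (integrableZl _ c iX). Qed.

Lemma L1B X Y : L1 X -> L1 Y -> L1 (fun t => X t - Y t).
Proof. by move=> iX iY; apply: (integrableB _ iX iY). Qed.

Lemma L1_sum (I : finType) (F : I -> T -> R) :
  (forall i, L1 (F i)) -> L1 (fun t => \sum_i F i t).
Proof.
move=> iF; have := @integrable_sum _ _ _ P setT measurableT _ (index_enum I)
  xpredT (fun i => EFin \o F i) (fun i _ => iF i).
by apply: eq_integrable => // t _ /=; rewrite sumEFin.
Qed.

Lemma ExD X Y : L1 X -> L1 Y -> Ex (fun t => X t + Y t) = Ex X + Ex Y.
Proof. exact: RintegralD. Qed.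

Lemma ExB X Y : L1 X -> L1 Y -> Ex (fun t => X t - Y t) = Ex X - Ex Y.
Proof. exact: RintegralB. Qed.

Lemma ExZ c X : L1 X -> Ex (fun t => c * X t) = c * Ex X.
Proof. exact: RintegralZl. Qed.

Lemma Ex_cst c : Ex (fun=> c) = c.
Proof.
transitivity (c * fine (P setT)); first exact: Rintegral_cst.
by rewrite probability_setT mulr1.
Qed.

Lemma Ex_sum (I : finType) (F : I -> T -> R) :
  (forall i, L1 (F i)) -> Ex (fun t => \sum_i F i t) = \sum_i Ex (F i).
Proof.
move=> iF; apply: EFin_inj; rewrite -expectation_Ex; last exact: L1_sum.
rewrite unlock -sumEFin.
under eq_integral do rewrite -sumEFin.
rewrite (@integral_sum _ _ _ P setT measurableT _ (fun i => EFin \o F i) iF).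
by apply: eq_bigr => i _; rewrite -expectation_Ex // unlock.
Qed.

Lemma le_Ex X Y : L1 X -> L1 Y -> (forall t, X t <= Y t) -> Ex X <= Ex Y.
Proof. by move=> iX iY XY; apply: le_Rintegral. Qed.

Lemma Ex_ge0 X : (forall t, 0 <= X t) -> 0 <= Ex X.
Proof. by move=> X0; apply: Rintegral_ge0. Qed.

Lemma L2_cst c : L2 (fun=> c).
Proof. by split; [exact: measurable_cst|exact: L1_cst]. Qed.

Lemma L2M X Y : L2 X -> L2 Y -> L1 (fun t => X t * Y t).
Proof.
move=> [mX iX] [mY iY].
apply: (@L1_le _ (fun t => X t ^+ 2 + Y t ^+ 2)); last exact: L1D.
  exact: measurable_funM.
move=> t; rewrite ler_norml.
have := sqr_ge0 (X t + Y t); have := sqr_ge0 (X t - Y t).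
have := sqr_ge0 (X t); have := sqr_ge0 (Y t); rewrite sqrrB sqrrD; nra.
Qed.

Lemma L2_le X Y : measurable_fun [set: T] X -> (forall t, X t ^+ 2 <= Y t) ->
  L1 Y -> L2 X.
Proof.
move=> mX XY iY; split=> //; apply: L1_le iY; first exact: measurable_funX.
by move=> t; rewrite ger0_norm ?sqr_ge0.
Qed.

Lemma L2Z c X : L2 X -> L2 (fun t => c * X t).
Proof.
move=> [mX iX]; split; first by apply: measurable_funM => //; exact: measurable_cst.
by under eq_fun do rewrite exprMn; exact: L1Z.
Qed.

Lemma L2D X Y : L2 X -> L2 Y -> L2 (fun t => X t + Y t).
Proof.
move=> X2 Y2; split; first by apply: measurable_funD; [case: X2|case: Y2].
under eq_fun do rewrite sqrrD; apply: L1D; last by case: Y2.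
apply: L1D; first by case: X2.
by under eq_fun do rewrite -mulr_natl; apply: L1Z; exact: L2M.
Qed.

Lemma L2_sum (I : finType) (F : I -> T -> R) :
  (forall i, L2 (F i)) -> L2 (fun t => \sum_i F i t).
Proof.
move=> F2; elim: (index_enum I) => [|i s IHs].
  by under eq_fun do rewrite big_nil; exact: L2_cst.
by under eq_fun do rewrite big_cons; exact: L2D.
Qed.

Lemma L2N X : L2 X -> L2 (fun t => - X t).
Proof. by under eq_fun do rewrite -mulN1r; exact: L2Z. Qed.

Definition vL2 {M : nat} (U : T -> 'rV[R]_M) : Prop :=
  forall j, L2 (fun t => U t 0 j).

Section Vectors.
Context {M : nat}.
Implicit Types U V : T -> 'rV[R]_M.

Lemma vL2_cst (u : 'rV[R]_M) : vL2 (fun=> u).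
Proof. by move=> j; exact: L2_cst. Qed.

Lemma vL2D U V : vL2 U -> vL2 V -> vL2 (fun t => U t + V t).
Proof. by move=> hU hV j; under eq_fun do rewrite mxE; exact: L2D. Qed.

Lemma vL2N U : vL2 U -> vL2 (fun t => - U t).
Proof. by move=> hU j; under eq_fun do rewrite mxE; exact: L2N. Qed.

Lemma vL2B U V : vL2 U -> vL2 V -> vL2 (fun t => U t - V t).
Proof. by move=> hU /vL2N; exact: vL2D. Qed.

Lemma vL2Z c U : vL2 U -> vL2 (fun t => c *: U t).
Proof. by move=> hU j; under eq_fun do rewrite mxE; exact: L2Z. Qed.

Lemma vL2_sum (I : finType) (F : I -> T -> 'rV[R]_M) :
  (forall i, vL2 (F i)) -> vL2 (fun t => \sum_i F i t).
Proof.
move=> hF j; under eq_fun do rewrite summxE.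
by apply: L2_sum => i; exact: hF.
Qed.

Lemma L1_dotv U V : vL2 U -> vL2 V -> L1 (fun t => dotv (U t) (V t)).
Proof. by move=> hU hV; apply: L1_sum => j; exact: L2M. Qed.

Lemma vL2_of_sq U Y : random_vector U -> (forall t, sq (U t) <= Y t) ->
  L1 Y -> vL2 U.
Proof.
move=> mU UY iY j; apply: L2_le iY => // t; apply: le_trans (UY t).
rewrite /dotv (bigD1 j) //= expr2 lerDl; apply: sumr_ge0 => i _.
by rewrite -expr2 sqr_ge0.
Qed.

Lemma random_vector_sq U : random_vector U ->
  measurable_fun [set: T] (fun t => sq (U t)).
Proof. by move=> mU; apply: measurable_sum => j; exact: measurable_funM. Qed.

Lemma mean_square_Ex U : vL2 U -> mean_square P U = (Ex (fun t => sq (U t)))%:E.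
Proof.
move=> hU; rewrite /mean_square; under eq_fun do rewrite l2norm_sq.
by rewrite expectation_Ex //; exact: L1_dotv.
Qed.

Lemma vL2_mean_square U : random_vector U -> (mean_square P U < +oo)%E -> vL2 U.
Proof.
move=> mU; rewrite /mean_square unlock => fU.
apply: (vL2_of_sq mU (Y := fun t => sq (U t))) => //.
apply/integrableP; split; first by apply/measurable_EFinP; exact: random_vector_sq.
apply: le_lt_trans fU; rewrite le_eqVlt; apply/orP; left; apply/eqP.
apply: eq_integral => t _ /=.
by rewrite l2norm_sq ger0_norm // sq_ge0.
Qed.

End Vectors.

End Moments.

(** * Orthogonality of centred noise to the past *)

Section Orthogonality.
Import HBSimple HBNNSimple.
Context {R : realType} {d : measure_display} {T : measurableType d}.
Variables (P : probability T R) (G : set (set T)).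
Hypothesis G_meas : <<s G >> `<=` measurable.

Lemma measurable_wrt_fun (Z : T -> R) :
  measurable_wrt <<s G >> Z -> measurable_fun [set: T] Z.
Proof. by move=> mZ _ B mB; rewrite setTI; apply: G_meas; exact: mZ. Qed.

Variable s : T -> R.
Hypothesis s_L1 : L1 P s.
Hypothesis s_mean0 : forall B, <<s G >> B -> (\int[P]_(t in B) (s t)%:E = 0)%E.

Lemma Ex_simple_orthogonal (f : {nnsfun (g_sigma_algebraType G) >-> R}) :
  Ex P (fun t => f t * s t) = 0.
Proof.
have fG y : <<s G >> (f @^-1` [set y]).
  exact: (measurable_sfunP f (measurable_set1 y)).
have iE B : <<s G >> B -> L1 P (fun t => \1_B t * s t).
  move=> GB; have mB := G_meas GB; apply: (L1_le (Y := fun t => `|s t|)).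
  - by apply: measurable_funM; [exact: measurable_indic|exact: L1_meas s_L1].
  - move=> t; rewrite normrM ler_piMl // indicE.
    by case: (_ \in _); rewrite ?normr1 ?normr0.
  - exact: integrable_norm.
have E0 B : <<s G >> B -> Ex P (fun t => \1_B t * s t) = 0.
  move=> GB; rewrite -[RHS]/(fine 0) -(s_mean0 GB) integral_mkcond; congr fine.
  apply: eq_integral => t _; rewrite patchE indicE.
  by case: (_ \in _); rewrite ?mul1r ?mul0r.
under [X in Ex P X]eq_fun do rewrite fimfunEord mulr_suml.
rewrite Ex_sum => [|i]; last first.
  by under eq_fun do rewrite -mulrA; apply: L1Z; exact: iE.
rewrite big1 // => i _; under [X in Ex P X]eq_fun do rewrite -mulrA.
by rewrite ExZ ?E0 ?mulr0 //; exact: iE.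
Qed.

Lemma Ex_orthogonal_ge0 (Z : T -> R) : measurable_wrt <<s G >> Z ->
  (forall t, 0 <= Z t) -> L1 P (fun t => Z t * s t) ->
  Ex P (fun t => Z t * s t) = 0.
Proof.
move=> mZ Z0 iZ.
have mZG : measurable_fun [set: g_sigma_algebraType G] (EFin \o Z).
  by apply/measurable_EFinP => _ B mB; rewrite setTI; exact: mZ.
pose f n := nnsfun_approx measurableT mZG n.
have Z0' t : [set: T] t -> (0 <= (Z t)%:E)%E by rewrite lee_fin.
have fZ n t : f n t <= Z t.
  by rewrite -lee_fin /f nnsfun_approxE; exact: le_approx.
have f0 n t : 0 <= f n t by [].
have mf n : measurable_fun [set: T] (f n).
  apply: measurable_wrt_fun => B mB.
  by have := @measurable_funPT _ _ _ _ (f n) measurableT B mB; rewrite setTI.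
have ms : measurable_fun [set: T] s by exact: L1_meas s_L1.
have cvgI := @dominated_cvg _ _ _ P setT measurableT
  (fun n t => (f n t * s t)%:E) (fun t => (Z t * s t)%:E)
  (fun t => `|Z t * s t|%:E).
have L : (\int[P]_t (f n t * s t)%:E)%E @[n --> \oo] --> (\int[P]_t (Z t * s t)%:E)%E.
  apply: cvgI => //.
  - by move=> n; apply/measurable_EFinP; exact: measurable_funM.
  - move=> t _; apply: cvg_EFin; first by near=> n.
    apply: cvgMl; have := cvg_nnsfun_approx measurableT mZG Z0' (x := t) I.
    by move/fine_cvg.
  - exact: integrable_norm.
  - move=> n t _; rewrite lee_fin !normrM ler_wpM2r // !ger0_norm //.
have i0 n : (\int[P]_t (f n t * s t)%:E = 0)%E.
  rewrite -[RHS]/(0%:E) -(Ex_simple_orthogonal (f n)) -expectation_Ex ?unlock //.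
  apply: (L1_le (Y := fun t => `|Z t * s t|)).
  - exact: measurable_funM.
  - by move=> t; rewrite !normrM ler_wpM2r // !ger0_norm.
  - exact: integrable_norm.
have -> : 0 = fine (0%E : \bar R) by [].
congr fine; apply/esym.
move: L; under eq_fun do rewrite i0; move=> L.
by apply: (cvg_unique _ _ L) => //; exact: cvg_cst.
Unshelve. all: by end_near. Qed.

(** Integrating against s annihilates the indicators of the sigma-algebra, hence
    its simple functions, hence by dominated convergence every function Z that is
    measurable for it. *)
Lemma Ex_orthogonal (Z : T -> R) : measurable_wrt <<s G >> Z ->
  L1 P (fun t => Z t * s t) -> Ex P (fun t => Z t * s t) = 0.
Proof.
move=> mZ iZ; have mZT := measurable_wrt_fun mZ.
have ms := L1_meas s_L1.
have mZG : measurable_fun [set: g_sigma_algebraType G] Z.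
  by move=> _ B mB; rewrite setTI; exact: mZ.
have m0 : measurable_fun [set: g_sigma_algebraType G] (fun=> 0 : R).
  exact: measurable_cst.
have mpos : measurable_wrt <<s G >> (fun t => Num.max (Z t) 0).
  move=> B mB; have := measurable_maxr mZG m0 measurableT mB.
  by rewrite setTI.
have mneg : measurable_wrt <<s G >> (fun t => Num.max (- Z t) 0).
  move=> B mB.
  have := measurable_maxr (measurable_funN mZG) m0 measurableT mB.
  by rewrite setTI.
have hi (X : T -> R) : measurable_wrt <<s G >> X ->
    (forall t, `|X t| <= `|Z t|) -> L1 P (fun t => X t * s t).
  move=> mX XZ; apply: (L1_le (Y := fun t => `|Z t * s t|)).
  - by apply: measurable_funM => //; exact: measurable_wrt_fun.
  - by move=> t; rewrite !normrM ler_wpM2r.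
  - exact: integrable_norm.
have ipos : L1 P (fun t => Num.max (Z t) 0 * s t).
  by apply: hi => // t; case: (leP (Z t)); rewrite ?normr0.
have ineg : L1 P (fun t => Num.max (- Z t) 0 * s t).
  by apply: hi => // t; case: (leP (- Z t)); rewrite ?normr0 ?normrN.
have -> : (fun t => Z t * s t) =
    (fun t => Num.max (Z t) 0 * s t - Num.max (- Z t) 0 * s t).
  apply/funext => t; rewrite -mulrBl; congr (_ * _).
  by case: (leP (Z t) 0) => h1; case: (leP (- Z t) 0) => h2; lra.
by rewrite ExB // !Ex_orthogonal_ge0 ?subrr // => t; rewrite le_max lexx orbT.
Qed.

End Orthogonality.

(** * Convex risks and their subgradients *)

Lemma rational_approx (R : realType) (M : nat) (w : 'rV[R]_M) (r : R) : 0 < r ->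
  exists u : 'rV[rat]_M, sq (w - map_mx ratr u) <= r.
Proof.
move=> r0; pose c := Num.sqrt (r / M.+1%:R).
have M0 : 0 < M.+1%:R :> R by rewrite ltr0n.
have c0 : 0 < c by rewrite sqrtr_gt0 divr_gt0.
have c2 : c * c = r / M.+1%:R by rewrite -expr2 sqr_sqrtr // divr_ge0 // ltW.
have /choice[a aP] : forall j, exists a : rat, ratr a \in `](w 0 j - c), (w 0 j + c)[.
  by move=> j; apply: rat_in_itvoo; lra.
exists (\row_j a j); apply: (@le_trans _ _ (\sum_(j < M) r / M.+1%:R)).
  apply: ler_sum => j _; rewrite !mxE -c2.
  by have := aP j; rewrite in_itv /= => /andP[h1 h2]; nra.
rewrite sumr_const card_ord -mulrnAr -[leRHS]mulr1 ler_pM2l //.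
by rewrite -mulr_natl ler_pdivrMr // mul1r ler_nat.
Qed.

Section ConvexRisk.
Context {R : realType} {M : nat}.
Variables (J : 'rV[R]_M -> R) (g : 'rV[R]_M -> 'rV[R]_M) (e f : R).
Hypothesis g_sub : forall w, subdifferential J w (g w).
Hypothesis J_lip : affine_lipschitz_subgradients e f J.
Implicit Types u w : 'rV[R]_M.

Lemma subgradient_le w u : J w + dotv (g w) (u - w) <= J u.
Proof. exact: g_sub. Qed.

Lemma subgradient_gap w u : J w - J u <= dotv (g w) (w - u).
Proof. by have := subgradient_le w u; rewrite -opprB dotvNr; lra. Qed.

(** Jensen's inequality needs only a subgradient at the barycentre. *)
Lemma risk_jensen (I : finType) (r : I -> R) (F : I -> 'rV[R]_M) :
  (forall i, 0 <= r i) -> \sum_i r i = 1 ->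
  J (\sum_i r i *: F i) <= \sum_i r i * J (F i).
Proof.
move=> r0 r1; set m := \sum_i _ *: _.
apply: (@le_trans _ _ (\sum_i r i * (J m + dotv (F i - m) (g m)))); last first.
  apply: ler_sum => i _; rewrite ler_wpM2l //.
  by rewrite dotvC subgradient_le.
under eq_bigr do rewrite mulrDr -dotvZl scalerBr.
rewrite big_split /= -mulr_suml r1 mul1r -dotv_suml sumrB -scaler_suml r1.
by rewrite scale1r -/m subrr dotv0l addr0.
Qed.

Lemma subgradient_lip w u v : subdifferential J u v ->
  sq (g w - v) <= e ^+ 2 * sq (w - u) + f ^+ 2.
Proof. by move=> uv; rewrite -!l2norm_sq; exact: J_lip. Qed.

Lemma subgradient_growth w u v : subdifferential J u v ->
  sq (g w) <= 2 * (e ^+ 2 * sq (w - u) + f ^+ 2) + 2 * sq v.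
Proof.
move=> uv; have := subgradient_lip w uv; have := sqD_le2 (g w - v) v.
by rewrite subrK; lra.
Qed.

Lemma risk_growth w u v : subdifferential J u v ->
  `|J w| <= `|J u| + sq v + (1 + e ^+ 2) * sq (w - u) + f ^+ 2.
Proof.
move=> uv; have lo := uv w; have hi := subgradient_gap w u.
have := young v (w - u) (@ltr01 R); have := young (- v) (w - u) (@ltr01 R).
have := young (g w) (w - u) (@ltr01 R); have := subgradient_growth w uv.
have := sq_ge0 v; have := sq_ge0 (w - u).
have := mulr_ge0 (sqr_ge0 e) (sq_ge0 (w - u)); have := sqr_ge0 f.
rewrite sqN dotvNl invr1 => *.
have := ler_norm (J u); have := lerNnormlW (lexx `|J u|) => *.
by rewrite ler_norml; apply/andP; split; nra.
Qed.

(** Subgradients at points close to w differ from g w by a bounded amount only,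
    so the tangent at such a point nearly reaches J w. *)
Lemma tangent_approx w (c : R) : 0 < c ->
  exists u : 'rV[rat]_M,
    let v := map_mx ratr u in J w - c <= J v + dotv (g v) (w - v).
Proof.
move=> c0; set K := e ^+ 2 + f ^+ 2 + 1.
have K0 : 0 < K by rewrite ltr_wpDl // addr_ge0 // sqr_ge0.
pose b := c / K; have b0 : 0 < b by rewrite divr_gt0.
have [|u uP] := @rational_approx R M w (Num.min 1 (b * c)).
  by rewrite lt_min ltr01 mulr_gt0.
exists u => /=; set v := map_mx ratr u in uP *.
move: uP; rewrite le_min => /andP[r1 rbc].
have := subgradient_gap w v; have := young (g w - g v) (w - v) b0.
have : b * sq (g w - g v) <= c.
  apply: (@le_trans _ _ (b * K)); last by rewrite divfK ?gt_eqF.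
  rewrite ler_pM2l //; apply: le_trans (subgradient_lip w (g_sub v)) _.
  have := ler_wpM2l (sqr_ge0 e) r1; rewrite /K; lra.
have : b^-1 * sq (w - v) <= c by rewrite ler_pdivrMl.
have : dotv (g w - g v) (w - v) = dotv (g w) (w - v) - dotv (g v) (w - v).
  by rewrite dotvDl dotvNl.
lra.
Qed.

Section Measurability.
Context {d : measure_display} {T : measurableType d}.
Variable P : probability T R.

(** A convex risk is the supremum of its tangents at the rational points. *)
Lemma measurable_risk (Y : T -> 'rV[R]_M) : random_vector Y ->
  measurable_fun [set: T] (fun t => J (Y t)).
Proof.
move=> mY.
pose pt n : 'rV[R]_M := map_mx ratr (odflt 0 (unpickle n : option 'rV[rat]_M)).
pose h n t := J (pt n) + dotv (g (pt n)) (Y t - pt n).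
have hJ n t : h n t <= J (Y t) by exact: subgradient_le.
have mh n : measurable_fun [set: T] (h n).
  apply: measurable_funD; first exact: measurable_cst.
  apply: measurable_sum => j; apply: measurable_funM; first exact: measurable_cst.
  under eq_fun do rewrite !mxE.
  by apply: measurable_funB; [exact: mY|exact: measurable_cst].
have ub t : has_ubound (range (h ^~ t)).
  by exists (J (Y t)) => _ [n _ <-].
have -> : (fun t => J (Y t)) = (fun t => sups (h ^~ t) 0%N).
  apply/funext => t; apply/le_anti/andP; split.
    apply/ler_addgt0Pr => c c0; have [u] := tangent_approx (Y t) c0.
    move=> /=; rewrite lerBlDr => uP; apply: le_trans uP _; rewrite lerD2r.
    have -> : J (map_mx ratr u) + dotv (g (map_mx ratr u)) (Y t - map_mx ratr u)
      = h (pickle u) t by rewrite /h /pt pickleK.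
    apply: sup_upper_bound; last by exists (pickle u).
    split; first by exists (h 0%N t); exists 0%N.
    by case: (ub t) => b bP; exists b => _ [n _ <-]; apply: bP; exists n.
  apply: ge_sup; first by exists (h 0%N t); exists 0%N.
  by move=> _ [n _ <-].
apply: measurable_fun_sups => // t _; exact: ub.
Qed.

Lemma L1_risk (Y : T -> 'rV[R]_M) u v : subdifferential J u v ->
  random_vector Y -> vL2 P (fun t => Y t - u) -> L1 P (fun t => J (Y t)).
Proof.
move=> uv mY Y2.
apply: (L1_le (Y := fun t =>
  `|J u| + sq v + (1 + e ^+ 2) * sq (Y t - u) + f ^+ 2)).
- exact: measurable_risk.
- by move=> t; exact: risk_growth.
- apply: L1D; last exact: L1_cst.
  apply: L1D; first exact: L1_cst.
  by apply: L1Z; exact: L1_dotv.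
Qed.

Lemma vL2_subgradient (Y : T -> 'rV[R]_M) u v : subdifferential J u v ->
  random_vector (g \o Y) -> vL2 P (fun t => Y t - u) -> vL2 P (fun t => g (Y t)).
Proof.
move=> uv mg Y2; apply: (vL2_of_sq mg (Y := fun t =>
    2 * (e ^+ 2 * sq (Y t - u) + f ^+ 2) + 2 * sq v)).
  by move=> t; exact: subgradient_growth.
apply: L1D; last exact: L1_cst.
apply: L1Z; apply: L1D; last exact: L1_cst.
by apply: L1Z; exact: L1_dotv.
Qed.

End Measurability.
End ConvexRisk.

Section StrongConvexity.
Context {R : realType} {M : nat}.
Variables (J : 'rV[R]_M -> R) (eta : R).
Hypothesis J_sconvex : strongly_convex eta J.
Implicit Types u w v : 'rV[R]_M.

Lemma strong_gap w u v : subdifferential J w v ->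
  J w - J u + eta / 2 * sq (u - w) <= dotv v (w - u).
Proof.
by move=> /(J_sconvex u); rewrite l2norm_sq -(opprB u w) dotvNr; lra.
Qed.

Lemma strong_monotone w u v v' : subdifferential J w v -> subdifferential J u v' ->
  eta * sq (w - u) <= dotv (v - v') (w - u).
Proof.
move=> /(strong_gap u) h1 /(strong_gap w) h2.
rewrite sqBC in h1; rewrite -(opprB w u) dotvNr in h2.
by rewrite [leRHS]dotvDl dotvNl; lra.
Qed.

(** Strong monotonicity bounds the slope of the subgradients from below by eta
    at large distances, where the constant f is negligible. *)
Lemma sconvex_le_lipschitz g e f : (0 < M)%N -> 0 < eta ->
  (forall w, subdifferential J w (g w)) ->
  affine_lipschitz_subgradients e f J -> eta ^+ 2 <= e ^+ 2.
Proof.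
move=> M0 eta0 g_sub J_lip; rewrite leNgt; apply/negP => ee.
have de : 0 < eta ^+ 2 - e ^+ 2 by rewrite subr_gt0.
(* a squared distance at which f ^+ 2 < (eta ^+ 2 - e ^+ 2) * s *)
pose s := f ^+ 2 / (eta ^+ 2 - e ^+ 2) + 1.
have s0 : 0 < s by rewrite ltr_wpDl // divr_ge0 ?sqr_ge0 // ltW.
pose w : 'rV[R]_M := Num.sqrt s *: delta_mx 0 (Ordinal M0).
have sw : sq (w - 0) = s.
  rewrite subr0 sqZ sqr_sqrtr ?(ltW s0) // /dotv (bigD1 (Ordinal M0)) //=.
  rewrite big1 => [|j jM]; first by rewrite !mxE !eqxx addr0 !mulr1.
  by rewrite mxE (negbTE jM) andbF mul0r.
have := subgradient_lip g_sub J_lip w (g_sub 0).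
have := strong_monotone (g_sub w) (g_sub 0).
have := young (g w - g 0) (w - 0) (c := eta^-1).
rewrite invr_gt0 invrK sw => /(_ eta0) h1 h2 h3.
have : eta * s <= eta^-1 * sq (g w - g 0) by lra.
rewrite ler_pdivlMl // mulrA -expr2 => h4.
have : (eta ^+ 2 - e ^+ 2) * s <= f ^+ 2 by rewrite mulrBl; lra.
by rewrite /s mulrDr mulrCA divff ?gt_eqF // !mulr1; lra.
Qed.

End StrongConvexity.

(** * One step of the algorithm in mean square *)

(** Integrability of polynomials of degree at most two in the coordinates of
    square-integrable vectors, by descent into the expression. *)
Ltac moments := repeat first
  [ assumption | match goal with H : forall k, _ |- _ => exact: H end
  | exact: L1_cst | exact: vL2_cst | apply: L1_dotv
  | apply: L1D | apply: L1B | apply: L1Z | (apply: L1_sum => ?)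
  | apply: vL2D | apply: vL2B | apply: vL2N | apply: vL2Z | (apply: vL2_sum => ?) ].

Section Step.
Context {R : realType} {N M : nat} {d : measure_display} {T : measurableType d}.
Variable P : probability T R.
Variables (A : 'M[R]_N) (p q eta e f beta sigma : 'I_N -> R).
Variables (J : 'I_N -> 'rV[R]_M -> R) (g : 'I_N -> 'rV[R]_M -> 'rV[R]_M).
Variables (wstar : 'rV[R]_M) (gstar : 'I_N -> 'rV[R]_M).
Hypothesis A_stoch : left_stochastic A.
Hypothesis A_perron : perron_vector A p.
Hypothesis q_pos : forall k, 0 < q k.
Hypothesis q_sum : \sum_k q k = 1.
Hypothesis J_sconvex : forall k, strongly_convex (eta k) (J k).
Hypothesis J_lip : forall k, affine_lipschitz_subgradients (e k) (f k) (J k).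
Hypothesis g_sub : forall k w, subdifferential (J k) w (g k w).
Hypothesis gstar_sub : forall k, subdifferential (J k) wstar (gstar k).
Hypothesis gstar_sum : \sum_k q k *: gstar k = 0.
Implicit Types (u s : 'I_N -> 'rV[R]_M).

Let p_gt0 k : 0 < p k. Proof. by case: A_perron. Qed.
Let p_sum : \sum_k p k = 1. Proof. by case: A_perron. Qed.

Definition avg_grad u : 'rV[R]_M := \sum_l q l *: g l (u l).

(** The subgradients chosen at wstar average to zero; subtracting them leaves
    differences of subgradients, to which the Lipschitz and monotonicity bounds
    apply. *)
Lemma avg_gradE u : avg_grad u = \sum_l q l *: (g l (u l) - gstar l).
Proof.
transitivity (avg_grad u - \sum_l q l *: gstar l); first by rewrite gstar_sum subr0.
by rewrite -sumrB; apply: eq_bigr => l _; rewrite scalerBr.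
Qed.

Lemma centroid_errorE u :
  centroid p u - wstar = \sum_l p l *: (u l - wstar).
Proof.
by under eq_bigr do rewrite scalerBr; rewrite sumrB -scaler_suml p_sum scale1r.
Qed.

Lemma energy_error u :
  \sum_l p l * sq (u l - wstar) =
    sq (centroid p u - wstar) + energy p (spread p u).
Proof.
have := variance (fun l => u l - wstar) p_sum; rewrite -centroid_errorE => h.
apply/eqP; rewrite addrC -subr_eq -h; apply/eqP; apply: eq_bigr => l _.
by rewrite /spread opprB addrA subrK.
Qed.

Lemma sq_avg_grad_le u :
  sq (avg_grad u) <= \sum_l q l * (e l ^+ 2 * sq (u l - wstar) + f l ^+ 2).
Proof.
rewrite avg_gradE.
apply: le_trans (sq_jensen _ _ q_sum) _ => [l|]; first exact: ltW.
apply: ler_sum => l _; rewrite ler_pM2l //.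
exact: (subgradient_lip (@g_sub l) (@J_lip l)).
Qed.

Lemma dotv_avg_grad u v : dotv (avg_grad u) v = \sum_l q l * dotv (g l (u l)) v.
Proof. by rewrite dotv_suml; apply: eq_bigr => l _; rewrite dotvZl. Qed.

(** The drift towards wstar, for stability.  Strong monotonicity gives twice the
    decrease that is kept: the other half absorbs, through Young's inequality
    with weights c l, the replacement of the mean by the local iterates. *)
Lemma avg_grad_stability (c : 'I_N -> R) u :
  (forall l, 0 < c l) -> (forall l, c l * e l ^+ 2 <= eta l) ->
  - 2 * dotv (avg_grad u) (centroid p u - wstar) <=
    \sum_l q l * (- eta l * sq (u l - wstar) + c l * f l ^+ 2
                  + (c l)^-1 * sq (spread p u l)).
Proof.
move=> c0 ce; rewrite avg_gradE dotv_suml mulr_sumr; apply: ler_sum => l _.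
rewrite dotvZl mulrCA ler_pM2l //.
have -> : centroid p u - wstar = (u l - wstar) - spread p u l.
  by rewrite /spread opprB [RHS]addrC addrA subrK.
have := strong_monotone (@J_sconvex l) (g_sub l (u l)) (gstar_sub l).
have := young (g l (u l) - gstar l) (spread p u l) (c0 l).
have := ler_wpM2l (ltW (c0 l))
  (subgradient_lip (@g_sub l) (@J_lip l) (u l) (gstar_sub l)).
have := ler_wpM2r (sq_ge0 (u l - wstar)) (ce l).
rewrite [dotv _ (_ - spread p u l)]dotvDr dotvNr mulrDr; lra.
Qed.

(** The same drift, for performance: the excess risks are retained, so a common
    weight c, which is later tuned to the size of the disagreement, replaces the
    weights that are adapted to the constants of each agent. *)
Lemma avg_grad_descent (c : R) u : 0 < c ->
  - 2 * dotv (avg_grad u) (centroid p u - wstar) <=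
    \sum_l q l * (2 * (J l wstar - J l (u l)) - eta l * sq (u l - wstar)
      + c * (2 * (e l ^+ 2 * sq (u l - wstar) + f l ^+ 2) + 2 * sq (gstar l))
      + c^-1 * sq (spread p u l)).
Proof.
move=> c0; rewrite dotv_avg_grad mulr_sumr; apply: ler_sum => l _.
rewrite mulrCA ler_pM2l //.
have -> : centroid p u - wstar = (u l - wstar) - spread p u l.
  by rewrite /spread opprB [RHS]addrC addrA subrK.
have := strong_gap (@J_sconvex l) wstar (g_sub l (u l)); rewrite sqBC.
have := young (g l (u l)) (spread p u l) c0.
have := ler_wpM2l (ltW c0)
  (subgradient_growth (@g_sub l) (@J_lip l) (u l) (gstar_sub l)).
rewrite [dotv _ (_ - spread p u l)]dotvDr dotvNr; lra.
Qed.

Variable mu_o : R.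
Hypothesis mu_o_gt0 : 0 < mu_o.
Let mu := step_size p q mu_o.

Let p_mu l : p l * mu l = q l * mu_o.
Proof. by rewrite /mu /step_size mulrA mulrCA divff ?mulr1 // gt_eqF. Qed.

Definition step u s : 'I_N -> 'rV[R]_M :=
  mix A (fun l => u l - mu l *: (g l (u l) + s l)).

(** The step sizes are proportional to q l / p l, so the weights p of the mean
    turn into the weights q of the global risk. *)
Lemma centroid_step u s :
  centroid p (step u s) = centroid p u - mu_o *: (avg_grad u + \sum_l q l *: s l).
Proof.
rewrite (centroid_mix A_perron) centroidB; congr (_ - _).
rewrite /avg_grad -big_split scaler_sumr; apply: eq_bigr => l _ /=.
by rewrite scalerA p_mu -scalerDr scalerA mulrC.
Qed.

(** What the one-step inequalities use of a random state W and of the noise S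
    that enters the next step: second moments, orthogonality of the noise to the
    state, and the bound on its power. *)
Record admissible (W S : 'I_N -> T -> 'rV[R]_M) : Prop := Admissible {
  error_L2 : forall k, vL2 P (fun t => W k t - wstar);
  subgradient_L2 : forall k, vL2 P (fun t => g k (W k t));
  noise_L2 : forall k, vL2 P (S k);
  noise_error0 : forall k l, Ex P (fun t => dotv (W l t - wstar) (S k t)) = 0;
  noise_subgradient0 : forall k l, Ex P (fun t => dotv (g l (W l t)) (S k t)) = 0;
  noise_variance : forall k, Ex P (fun t => sq (S k t))
    <= beta k ^+ 2 * Ex P (fun t => sq (W k t - wstar)) + sigma k ^+ 2 }.

Lemma Ex_dotv_sum0 (r r' : 'I_N -> R) (U V : 'I_N -> T -> 'rV[R]_M) :
  (forall k, vL2 P (U k)) -> (forall k, vL2 P (V k)) ->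
  (forall k l, Ex P (fun t => dotv (U l t) (V k t)) = 0) ->
  Ex P (fun t => dotv (\sum_l r l *: U l t) (\sum_k r' k *: V k t)) = 0.
Proof.
move=> hU hV UV0.
have -> : (fun t => dotv (\sum_l r l *: U l t) (\sum_k r' k *: V k t)) =
    (fun t => \sum_l \sum_k r l * (r' k * dotv (U l t) (V k t))).
  apply/funext => t; rewrite dotv_suml; apply: eq_bigr => l _.
  rewrite dotvZl dotvC dotv_suml mulr_sumr; apply: eq_bigr => k _.
  by rewrite dotvZl dotvC.
rewrite Ex_sum; last by move=> l; moments.
rewrite big1 // => l _; rewrite Ex_sum; last by move=> k; moments.
by rewrite big1 // => k _; rewrite !ExZ ?UV0 ?mulr0 //; moments.
Qed.

Variables W S : 'I_N -> T -> 'rV[R]_M.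
Hypothesis adm : admissible W S.

Let x k := Ex P (fun t => sq (W k t - wstar)).
Let a := Ex P (fun t => sq (centroid p (W^~ t) - wstar)).

Let hW := error_L2 adm.
Let hg := subgradient_L2 adm.
Let hS := noise_L2 adm.

Lemma centroid_L2 : vL2 P (fun t => centroid p (W^~ t) - wstar).
Proof. by under eq_fun do rewrite centroid_errorE; moments. Qed.

Lemma spread_L2 k : vL2 P (fun t => spread p (W^~ t) k).
Proof.
have h := centroid_L2.
have -> : (fun t => spread p (W^~ t) k) =
    (fun t => (W k t - wstar) - (centroid p (W^~ t) - wstar)).
  by apply/funext => t; rewrite /spread opprB addrA subrK.
by moments.
Qed.

Lemma avg_grad_L2 : vL2 P (fun t => avg_grad (W^~ t)).
Proof. by rewrite /avg_grad; moments. Qed.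

Lemma energy_spread_L1 : L1 P (fun t => energy p (spread p (W^~ t))).
Proof. by have h := spread_L2; rewrite /energy; moments. Qed.

Lemma Ex_energy_error :
  \sum_l p l * x l = a + Ex P (fun t => energy p (spread p (W^~ t))).
Proof.
have h := centroid_L2; have h' := energy_spread_L1.
rewrite -ExD //; last by moments.
under [in RHS]eq_fun do rewrite -energy_error.
rewrite Ex_sum; last by move=> l; moments.
by apply: eq_bigr => l _; rewrite ExZ //; moments.
Qed.

Lemma a_le_x : a <= \sum_l p l * x l.
Proof.
rewrite Ex_energy_error lerDl; apply: Ex_ge0 => t.
exact: (energy_ge0 A_perron).
Qed.

(** The averaged noise is orthogonal to everything that the step starts from,
    and by convexity its power is at most the average power. *)
Lemma centroid_recursion :
  Ex P (fun t => sq (centroid p (step (W^~ t) (S^~ t)) - wstar)) <=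
    a - 2 * mu_o *
      Ex P (fun t => dotv (avg_grad (W^~ t)) (centroid p (W^~ t) - wstar))
    + mu_o ^+ 2 * \sum_l q l * ((e l ^+ 2 + beta l ^+ 2) * x l
                                + (f l ^+ 2 + sigma l ^+ 2)).
Proof.
have hc := centroid_L2; have hp := avg_grad_L2.
pose c t := centroid p (W^~ t) - wstar; pose G t := avg_grad (W^~ t).
pose s t := \sum_l q l *: S l t.
have hs : vL2 P s by rewrite /s; moments.
pose Q t := \sum_l q l * (e l ^+ 2 * sq (W l t - wstar) + f l ^+ 2).
pose V t := \sum_l q l * sq (S l t).
have iQ : L1 P Q by rewrite /Q; moments.
have iV : L1 P V by rewrite /V; moments.
have icG : L1 P (fun t => dotv (G t) (c t)) by moments.
have ics : L1 P (fun t => dotv (c t) (s t)) by moments.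
have iGs : L1 P (fun t => dotv (G t) (s t)) by moments.
have icc : L1 P (fun t => sq (c t)) by moments.
have cs0 : Ex P (fun t => dotv (c t) (s t)) = 0.
  rewrite /c; under [X in Ex P X]eq_fun do rewrite centroid_errorE.
  by apply: Ex_dotv_sum0 => //; exact: noise_error0 adm.
have Gs0 : Ex P (fun t => dotv (G t) (s t)) = 0.
  by apply: Ex_dotv_sum0 => //; exact: noise_subgradient0 adm.
have EQ : Ex P Q = \sum_l q l * (e l ^+ 2 * x l + f l ^+ 2).
  rewrite Ex_sum; last by move=> l; moments.
  apply: eq_bigr => l _; rewrite ExZ; last by moments.
  rewrite ExD ?Ex_cst ?ExZ //; moments.
have EV : Ex P V <= \sum_l q l * (beta l ^+ 2 * x l + sigma l ^+ 2).
  rewrite Ex_sum; last by move=> l; moments.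
  apply: ler_sum => l _; rewrite ExZ; last by moments.
  by rewrite ler_pM2l //; exact: noise_variance adm _.
have i1 : L1 P (fun t => sq (c t) - 2 * mu_o * dotv (G t) (c t)).
  by apply: L1B => //; exact: L1Z.
have i2 : L1 P (fun t => mu_o ^+ 2 * (Q t + V t)) by apply: L1Z; exact: L1D.
have i3 : L1 P (fun t => 2 * mu_o ^+ 2 * dotv (G t) (s t)
    - 2 * mu_o * dotv (c t) (s t)) by apply: L1B; exact: L1Z.
apply: (@le_trans _ _ (Ex P (fun t => (sq (c t) - 2 * mu_o * dotv (G t) (c t)
    + mu_o ^+ 2 * (Q t + V t))
    + (2 * mu_o ^+ 2 * dotv (G t) (s t) - 2 * mu_o * dotv (c t) (s t))))).
  apply: le_Ex.
  - under eq_fun do rewrite centroid_step addrAC.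
    by apply: L1_dotv; apply: vL2B => //; apply: vL2Z; exact: vL2D.
  - by apply: L1D => //; exact: L1D.
  move=> t; rewrite centroid_step addrAC -/(c t) -/(G t) -/(s t).
  have Qt : sq (G t) <= Q t by exact: sq_avg_grad_le.
  have Vt : sq (s t) <= V t by apply: sq_jensen => // l; exact: ltW.
  rewrite sqD sqN sqZ (sqD (G t)) dotvNr dotvZr dotvDr (dotvC (c t) (G t)).
  have := ler_wpM2l (ltW (exprn_gt0 2 mu_o_gt0)) (lerD Qt Vt).
  lra.
rewrite ExD //; last exact: L1D.
rewrite ExD // !ExB //; try exact: L1Z.
rewrite !ExZ //; last exact: L1D.
rewrite ExD // cs0 Gs0 EQ !mulr0 subr0 addr0 lerD2l.
rewrite ler_pM2l ?exprn_gt0 //; apply: le_trans (lerD (lexx _) EV) _.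
rewrite -big_split le_eqVlt; apply/orP; left; apply/eqP.
by apply: eq_bigr => l _ /=; ring.
Qed.

Lemma iter_mix_L2 n (U : 'I_N -> T -> 'rV[R]_M) :
  (forall k, vL2 P (U k)) ->
  forall k, vL2 P (fun t => iter n (mix A) (U^~ t) k).
Proof.
move=> hU; elim: n => [//|n IHn] k /=.
by rewrite /mix; apply: vL2_sum => l; apply: vL2Z; exact: IHn.
Qed.

Lemma lyapunov_L1 n : L1 P (fun t => lyapunov A p n (W^~ t)).
Proof.
apply: L1_sum => m; apply: L1_sum => k; apply: L1Z.
have h := @iter_mix_L2 m (fun k t => spread p (W^~ t) k) spread_L2 k.
exact: L1_dotv.
Qed.

Lemma error_step_L2 k : vL2 P (fun t => step (W^~ t) (S^~ t) k - wstar).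
Proof.
have E t : step (W^~ t) (S^~ t) k - wstar =
    \sum_l A l k *: ((W l t - wstar) - mu l *: (g l (W l t) + S l t)).
  rewrite /step /mix -[X in _ - X]scale1r -(A_stoch.2 k) scaler_suml -sumrB.
  by apply: eq_bigr => l _; rewrite -scalerBr addrAC.
under eq_fun do rewrite E; apply: vL2_sum => l; apply: vL2Z; apply: vL2B => //.
by apply: vL2Z; exact: vL2D.
Qed.

Lemma x_ge0 k : 0 <= x k.
Proof. by apply: Ex_ge0 => t; exact: sq_ge0. Qed.

Lemma Ex_sq_spread_le k : Ex P (fun t => sq (spread p (W^~ t) k))
  <= (p k)^-1 * Ex P (fun t => energy p (spread p (W^~ t))).
Proof.
have h := spread_L2; rewrite -ExZ; last exact: energy_spread_L1.
apply: le_Ex; [exact: L1_dotv|by apply: L1Z; exact: energy_spread_L1|].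
by move=> t; rewrite ler_pdivlMl //; exact: (sq_le_energy A_perron).
Qed.

Section Stability.
Variables (n : nat).
Let v := Ex P (fun t => lyapunov A p n.+1 (W^~ t)).

Lemma energy_spread_le_v : Ex P (fun t => energy p (spread p (W^~ t))) <= v.
Proof.
apply: le_Ex; [exact: energy_spread_L1|exact: lyapunov_L1|].
by move=> t; exact: (energy_spread_le_lyapunov A_perron).
Qed.

Lemma sum_x_le : \sum_l p l * x l <= a + v.
Proof. by rewrite Ex_energy_error lerD2l energy_spread_le_v. Qed.

Lemma x_le k : x k <= (p k)^-1 * (a + v).
Proof.
rewrite ler_pdivlMl //; apply: le_trans sum_x_le.
rewrite (bigD1 k) //= lerDl; apply: sumr_ge0 => l _.
by rewrite mulr_ge0 ?x_ge0 // ltW.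
Qed.

(** The coefficients are independent of mu_o: kappa is the contraction, and the
    sums collect the effect of the disagreement and of the second-order terms. *)
Lemma stability_recursion (c : 'I_N -> R) (kappa : R) :
  (forall l, 0 < c l) -> (forall l, c l * e l ^+ 2 <= eta l) ->
  0 < kappa -> (forall l, kappa * p l <= q l * eta l) ->
  Ex P (fun t => sq (centroid p (step (W^~ t) (S^~ t)) - wstar)) <=
    (1 - mu_o * kappa) * a
    + mu_o * (\sum_l q l * (c l * f l ^+ 2 + (c l)^-1 * (p l)^-1)) * (1 + v)
    + mu_o ^+ 2 * (\sum_l q l * ((e l ^+ 2 + beta l ^+ 2) * (p l)^-1
                                 + (f l ^+ 2 + sigma l ^+ 2))) * (a + v + 1).
Proof.
move=> c0 ce kappa0 kp; apply: le_trans centroid_recursion _.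
have hc := centroid_L2; have hp := avg_grad_L2; have hd := spread_L2.
have v0 : 0 <= v by apply: Ex_ge0 => t; exact: (lyapunov_ge0 A_perron).
have a0 : 0 <= a by apply: Ex_ge0 => t; exact: sq_ge0.
have ix l : L1 P (fun t => sq (W l t - wstar)) by exact: L1_dotv.
have id l : L1 P (fun t => sq (spread p (W^~ t) l)) by exact: L1_dotv.
have it l : L1 P (fun t => q l * (- eta l * sq (W l t - wstar)
    + c l * f l ^+ 2 + (c l)^-1 * sq (spread p (W^~ t) l))).
  apply: L1Z; apply: L1D; last exact: L1Z.
  by apply: L1D; [exact: L1Z|exact: L1_cst].
have drift : - 2 *
      Ex P (fun t => dotv (avg_grad (W^~ t)) (centroid p (W^~ t) - wstar))
    <= \sum_l q l * (- eta l * x l + c l * f l ^+ 2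
         + (c l)^-1 * Ex P (fun t => sq (spread p (W^~ t) l))).
  rewrite -ExZ; last exact: L1_dotv.
  apply: (@le_trans _ _ (Ex P (fun t => \sum_l q l * (- eta l * sq (W l t - wstar)
    + c l * f l ^+ 2 + (c l)^-1 * sq (spread p (W^~ t) l))))).
    apply: le_Ex; [by apply: L1Z; exact: L1_dotv|exact: L1_sum|].
    by move=> t; exact: avg_grad_stability.
  rewrite Ex_sum // le_eqVlt; apply/orP; left; apply/eqP; apply: eq_bigr => l _.
  have i1 : L1 P (fun t => - eta l * sq (W l t - wstar)) by exact: L1Z.
  have i2 : L1 P (fun t => (c l)^-1 * sq (spread p (W^~ t) l)) by exact: L1Z.
  have i3 := L1_cst P (c l * f l ^+ 2).
  rewrite ExZ; last by apply: L1D => //; exact: L1D.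
  by rewrite ExD //; [rewrite ExD // Ex_cst !ExZ|exact: L1D].
have contraction : \sum_l q l * (- eta l * x l) <= - (kappa * a).
  apply: (@le_trans _ _ (- (kappa * \sum_l p l * x l))).
    rewrite mulr_sumr -sumrN; apply: ler_sum => l _.
    by have := ler_wpM2r (x_ge0 l) (kp l); lra.
  by rewrite lerN2 ler_pM2l // a_le_x.
have perturbation : \sum_l q l * (c l * f l ^+ 2
      + (c l)^-1 * Ex P (fun t => sq (spread p (W^~ t) l)))
    <= (\sum_l q l * (c l * f l ^+ 2 + (c l)^-1 * (p l)^-1)) * (1 + v).
  rewrite mulr_suml; apply: ler_sum => l _; rewrite -mulrA ler_pM2l //.
  have ci : 0 <= (c l)^-1 by rewrite invr_ge0 ltW.
  have pi : 0 <= (p l)^-1 by rewrite invr_ge0 ltW.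
  have := le_trans (Ex_sq_spread_le l) (ler_wpM2l pi energy_spread_le_v).
  move=> /(ler_wpM2l ci); have := mulr_ge0 ci pi.
  have := mulr_ge0 (mulr_ge0 (ltW (c0 l)) (sqr_ge0 (f l))) v0.
  lra.
have second_order : \sum_l q l * ((e l ^+ 2 + beta l ^+ 2) * x l
      + (f l ^+ 2 + sigma l ^+ 2))
    <= (\sum_l q l * ((e l ^+ 2 + beta l ^+ 2) * (p l)^-1
                                 + (f l ^+ 2 + sigma l ^+ 2))) * (a + v + 1).
  rewrite mulr_suml; apply: ler_sum => l _; rewrite -mulrA ler_pM2l //.
  have eb : 0 <= e l ^+ 2 + beta l ^+ 2 by rewrite addr_ge0 ?sqr_ge0.
  have fs : 0 <= f l ^+ 2 + sigma l ^+ 2 by rewrite addr_ge0 ?sqr_ge0.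
  have pi : 0 <= (p l)^-1 by rewrite invr_ge0 ltW.
  have := ler_wpM2l eb (x_le l); have := mulr_ge0 eb pi.
  have := mulr_ge0 fs (addr_ge0 a0 v0).
  lra.
have split : \sum_l q l * (- eta l * x l + c l * f l ^+ 2
         + (c l)^-1 * Ex P (fun t => sq (spread p (W^~ t) l))) =
    \sum_l q l * (- eta l * x l) + \sum_l q l * (c l * f l ^+ 2
      + (c l)^-1 * Ex P (fun t => sq (spread p (W^~ t) l))).
  by rewrite -big_split; apply: eq_bigr => l _ /=; rewrite -mulrDr addrA.
move: drift; rewrite split => drift.
have := ler_wpM2l (ltW mu_o_gt0)
  (le_trans drift (lerD contraction perturbation)).
have := ler_wpM2l (ltW (exprn_gt0 2 mu_o_gt0)) second_order.
lra.
Qed.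

(** The subgradients and the noise enter the disagreement multiplied by step
    sizes of order mu_o, hence the factor mu_o^2. *)
Lemma disagreement_recursion (r K : R) : 0 <= K ->
  (forall u u', lyapunov A p n.+1 (mix A (fun k => u k - u' k))
      <= r * lyapunov A p n.+1 u + K * energy p u') ->
  Ex P (fun t => lyapunov A p n.+1 (step (W^~ t) (S^~ t))) <=
    r * v + mu_o ^+ 2 * (K * \sum_l q l ^+ 2 * (p l)^-1 *
      ((4 * e l ^+ 2 + 2 * beta l ^+ 2) * (p l)^-1
        + (4 * f l ^+ 2 + 4 * sq (gstar l) + 2 * sigma l ^+ 2))) * (a + v + 1).
Proof.
move=> K0 KP.
have v0 : 0 <= v by apply: Ex_ge0 => t; exact: (lyapunov_ge0 A_perron).
have a0 : 0 <= a by apply: Ex_ge0 => t; exact: sq_ge0.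
have ix l : L1 P (fun t => sq (W l t - wstar)) by exact: L1_dotv.
have isq l : L1 P (fun t => sq (S l t)) by exact: L1_dotv.
pose U l t := 2 * (2 * (e l ^+ 2 * sq (W l t - wstar) + f l ^+ 2)
                   + 2 * sq (gstar l)) + 2 * sq (S l t).
have i1 l : L1 P (fun t => e l ^+ 2 * sq (W l t - wstar) + f l ^+ 2).
  by apply: L1D; [exact: L1Z|exact: L1_cst].
have i2 l : L1 P (fun t => 2 * (e l ^+ 2 * sq (W l t - wstar) + f l ^+ 2)
                   + 2 * sq (gstar l)).
  by apply: L1D; [exact: L1Z|exact: L1_cst].
have iU l : L1 P (U l) by apply: L1D; exact: L1Z.
have EU l : Ex P (U l) <= ((4 * e l ^+ 2 + 2 * beta l ^+ 2) * (p l)^-1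
        + (4 * f l ^+ 2 + 4 * sq (gstar l) + 2 * sigma l ^+ 2)) * (a + v + 1).
  have -> : Ex P (U l) = 2 * (2 * (e l ^+ 2 * x l + f l ^+ 2)
                   + 2 * sq (gstar l)) + 2 * Ex P (fun t => sq (S l t)).
    rewrite /U ExD; [|exact: L1Z|exact: L1Z]; rewrite !(ExZ 2) //.
    rewrite ExD; [|exact: L1Z|exact: L1_cst]; rewrite Ex_cst (ExZ 2) //.
    by rewrite ExD; [rewrite Ex_cst ExZ|exact: L1Z|exact: L1_cst].
  have eb : 0 <= 4 * e l ^+ 2 + 2 * beta l ^+ 2.
    by rewrite addr_ge0 // mulr_ge0 ?sqr_ge0.
  have fs : 0 <= 4 * f l ^+ 2 + 4 * sq (gstar l) + 2 * sigma l ^+ 2.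
    by rewrite !addr_ge0 // mulr_ge0 ?sqr_ge0 ?sq_ge0.
  have pi : 0 <= (p l)^-1 by rewrite invr_ge0 ltW.
  have := ler_wpM2l eb (x_le l); have := mulr_ge0 eb pi.
  have := mulr_ge0 fs (addr_ge0 a0 v0); have := noise_variance adm l.
  rewrite -/(x l); lra.
pose w l := mu_o ^+ 2 * (q l ^+ 2 * (p l)^-1).
have w0 l : 0 <= w l.
  by rewrite !mulr_ge0 ?exprn_ge0 ?invr_ge0 // ltW.
have wE l : w l = p l * mu l ^+ 2.
  by rewrite /w /mu /step_size; field; rewrite gt_eqF.
apply: (@le_trans _ _ (Ex P (fun t => r * lyapunov A p n.+1 (W^~ t)
    + K * \sum_l w l * U l t))).
  apply: le_Ex.
  - have h : forall k, vL2 P (fun t => spread p (step (W^~ t) (S^~ t)) k).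
      have hs := error_step_L2 => k.
      have -> : (fun t => spread p (step (W^~ t) (S^~ t)) k) =
        (fun t => (step (W^~ t) (S^~ t) k - wstar)
                  - \sum_l p l *: (step (W^~ t) (S^~ t) l - wstar)).
        by apply/funext => t; rewrite -centroid_errorE opprB addrA subrK.
      by apply: vL2B => //; apply: vL2_sum => l; exact: vL2Z.
    apply: L1_sum => m; apply: L1_sum => k; apply: L1Z.
    have := @iter_mix_L2 m (fun k t => spread p (step (W^~ t) (S^~ t)) k) h k.
    by move=> h'; exact: L1_dotv.
  - apply: L1D; first by apply: L1Z; exact: lyapunov_L1.
    by apply: L1Z; apply: L1_sum => l; exact: L1Z.
  move=> t; apply: le_trans (KP _ _) _; rewrite lerD2l ler_wpM2l //.
  apply: ler_sum => l _; rewrite wE -mulrA ler_pM2l // sqZ ler_wpM2l ?sqr_ge0 //.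
  apply: le_trans (sqD_le2 _ _) _; rewrite lerD2r ler_pM2l //.
  exact: (subgradient_growth (@g_sub l) (@J_lip l)).
have iS : L1 P (fun t => \sum_l w l * U l t) by apply: L1_sum => l; exact: L1Z.
rewrite ExD; [|by apply: L1Z; exact: lyapunov_L1|exact: L1Z].
rewrite !ExZ //; last exact: lyapunov_L1.
rewrite lerD2l [mu_o ^+ 2 * (K * _)]mulrCA -(mulrA K) ler_wpM2l //.
rewrite Ex_sum => [|l]; last exact: L1Z.
rewrite mulr_sumr mulr_suml; apply: ler_sum => l _; rewrite ExZ //.
by apply: le_trans (ler_wpM2l (w0 l) (EU l)) _; rewrite /w !mulrA.
Qed.

End Stability.

(** The drift is bounded by the inequality of strong convexity between W and
    wstar.  Young's inequality with weight h * mu_o balances the disagreement,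
    of order (h * mu_o)^2, against the subgradients, of order 1. *)
Lemma descent_recursion (h alpha : R) : 0 < h ->
  (forall k, Ex P (fun t => sq (spread p (W^~ t) k)) <= h ^+ 2 * mu_o ^+ 2) ->
  (forall l, 1 - mu l * (eta l - mu_o * e l ^+ 2 - mu_o * beta l ^+ 2
                         - 2 * mu_o * h * e l ^+ 2) <= alpha) ->
  alpha <= 1 ->
  Ex P (fun t => sq (centroid p (step (W^~ t) (S^~ t)) - wstar)) <=
    alpha * a - 2 * mu_o * (\sum_l q l * (Ex P (fun t => J l (W l t)) - J l wstar))
    + 2 * mu_o * performance_bound q f sigma gstar h mu_o.
Proof.
move=> h0 dis al al1; apply: le_trans centroid_recursion _.
have hc := centroid_L2; have hp := avg_grad_L2; have hd := spread_L2.
have hm0 : 0 < h * mu_o by rewrite mulr_gt0.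
have ix l : L1 P (fun t => sq (W l t - wstar)) by exact: L1_dotv.
have id l : L1 P (fun t => sq (spread p (W^~ t) l)) by exact: L1_dotv.
have mW l : random_vector (W l).
  have := vL2D (hW l) (vL2_cst P wstar).
  by under eq_fun do rewrite subrK; move=> h2 j; case: (h2 j).
have iJ l : L1 P (fun t => J l (W l t)).
  exact: (L1_risk (@g_sub l) (@J_lip l) (gstar_sub l) (mW l) (hW l)).
pose F l t := 2 * (J l wstar - J l (W l t)) - eta l * sq (W l t - wstar)
  + h * mu_o * (2 * (e l ^+ 2 * sq (W l t - wstar) + f l ^+ 2) + 2 * sq (gstar l))
  + (h * mu_o)^-1 * sq (spread p (W^~ t) l).
have i1 l : L1 P (fun t => J l wstar - J l (W l t)).
  by apply: L1B => //; exact: L1_cst.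
have i2 l : L1 P (fun t => 2 * (J l wstar - J l (W l t))
    - eta l * sq (W l t - wstar)) by apply: L1B; exact: L1Z.
have i3 l : L1 P (fun t => e l ^+ 2 * sq (W l t - wstar) + f l ^+ 2).
  by apply: L1D; [exact: L1Z|exact: L1_cst].
have i4 l : L1 P (fun t => 2 * (e l ^+ 2 * sq (W l t - wstar) + f l ^+ 2)
    + 2 * sq (gstar l)) by apply: L1D; [exact: L1Z|exact: L1_cst].
have i5 l : L1 P (fun t => 2 * (J l wstar - J l (W l t))
  - eta l * sq (W l t - wstar) + h * mu_o *
    (2 * (e l ^+ 2 * sq (W l t - wstar) + f l ^+ 2) + 2 * sq (gstar l))).
  by apply: L1D => //; exact: L1Z.
have iF l : L1 P (F l) by apply: L1D => //; exact: L1Z.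
have EF l : Ex P (F l) <= 2 * (J l wstar - Ex P (fun t => J l (W l t)))
    - eta l * x l
    + h * mu_o * (2 * (e l ^+ 2 * x l + f l ^+ 2) + 2 * sq (gstar l)) + h * mu_o.
  rewrite /F ExD //; last exact: L1Z.
  rewrite (ExD (i2 l)); last exact: L1Z.
  rewrite (ExB (L1Z _ (i1 l)) (L1Z _ (ix l))) !ExZ // ExB //; last exact: L1_cst.
  rewrite (ExD (L1Z _ (i3 l)) (L1_cst _ _)) (ExZ _ (i3 l)).
  rewrite (ExD (L1Z _ (ix l)) (L1_cst _ _)) (ExZ _ (ix l)) !Ex_cst.
  by rewrite lerD2l ler_pdivrMl // -expr2 exprMn.
have drift : - 2 *
      Ex P (fun t => dotv (avg_grad (W^~ t)) (centroid p (W^~ t) - wstar))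
    <= \sum_l q l * Ex P (F l).
  rewrite -ExZ; last exact: L1_dotv.
  have -> : \sum_l q l * Ex P (F l) = Ex P (fun t => \sum_l q l * F l t).
    by rewrite Ex_sum => [|l]; [apply: eq_bigr => l _; rewrite ExZ|exact: L1Z].
  apply: le_Ex; [by apply: L1Z; exact: L1_dotv|by apply: L1_sum => l; exact: L1Z|].
  by move=> t; exact: avg_grad_descent.
have total : mu_o * (\sum_l q l * Ex P (F l))
    + mu_o ^+ 2 * \sum_l q l * ((e l ^+ 2 + beta l ^+ 2) * x l
                                + (f l ^+ 2 + sigma l ^+ 2))
  <= (alpha - 1) * (\sum_l p l * x l)
     - 2 * mu_o * (\sum_l q l * (Ex P (fun t => J l (W l t)) - J l wstar))
     + 2 * mu_o * performance_bound q f sigma gstar h mu_o.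
  have -> : 2 * mu_o * performance_bound q f sigma gstar h mu_o = mu_o ^+ 2 *
    \sum_k (q k * f k ^+ 2 + q k * sigma k ^+ 2
      + 2 * h * q k * (f k ^+ 2 + sq (gstar k) + 1 / 2)).
    rewrite /performance_bound; under eq_bigr do rewrite l2norm_sq.
    by set s := \sum_k _; field.
  rewrite !mulr_sumr -!big_split -sumrB -big_split; apply: ler_sum => l _ /=.
  have := ler_wpM2l (ltW (mulr_gt0 mu_o_gt0 (q_pos l))) (EF l).
  have := ler_wpM2r (x_ge0 l) (ler_wpM2l (ltW (p_gt0 l)) (al l)).
  rewrite mulrBr [p l * (mu l * _)]mulrA p_mu; lra.
have : (alpha - 1) * (\sum_l p l * x l) <= (alpha - 1) * a.
  by rewrite ler_wnM2l ?subr_le0 // a_le_x.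
have := ler_wpM2l (ltW mu_o_gt0) drift; lra.
Qed.

End Step.

(** * The iterates *)

Section Iterates.
Context {R : realType} {N M : nat} {d : measure_display} {T : measurableType d}.
Variable P : probability T R.
Variables (w : nat -> 'I_N -> T -> 'rV[R]_M).

Lemma past_measurable i : (forall j k, (j <= i)%N -> random_vector (w j k)) ->
  past w i `<=` measurable.
Proof.
move=> mw; apply: smallest_sub; first exact: sigma_algebra_measurable.
move=> B [[[j k] l] /= ji [C mC <-]].
exact: (mw _ _ ji l measurableT _ mC).
Qed.

Lemma past_iterate i k (l : 'I_M) :
  measurable_wrt (past w i) (fun t => w i k t 0 l).
Proof.
move=> B mB; apply: sub_sigma_algebra; exists (i, k, l) => //=.
by exists B => //; rewrite setTI.
Qed.

Lemma measurable_wrt_comp (F : set (set T)) (Y : T -> R) (phi : R -> R) :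
  measurable_fun [set: R] phi -> measurable_wrt F Y -> measurable_wrt F (phi \o Y).
Proof.
move=> mphi mY B mB; rewrite comp_preimage; apply: mY.
by rewrite -[X in measurable X]setTI; exact: mphi.
Qed.

Lemma cond_expectation_le G (X V Y : T -> R) :
  cond_expectation P <<s G >> X V -> L1 P Y -> {ae P, forall t, V t <= Y t} ->
  Ex P X <= Ex P Y.
Proof.
move=> [iX iV _ XV] iY VY; have GT : <<s G >> [set: T].
  exact: (@measurableT _ (g_sigma_algebraType G)).
have mV := L1_meas iV; have mY := L1_meas iY.
(* the minimum is almost surely V and lies below Y everywhere *)
have mmin : measurable_fun [set: T] (fun t => Num.min (V t) (Y t)).
  exact: measurable_minr.
have imin : L1 P (fun t => Num.min (V t) (Y t)).
  apply: (L1_le (Y := fun t => `|V t| + `|Y t|)) => //.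
    move=> t; case: (leP (V t)) => _; first by rewrite lerDl.
    by rewrite lerDr.
  by apply: L1D; exact: integrable_norm.
have -> : Ex P X = Ex P (fun t => Num.min (V t) (Y t)).
  congr fine; rewrite XV //; apply: ae_eq_integral => //.
  - exact/measurable_EFinP.
  - exact/measurable_EFinP.
  - by apply: filterS VY => t VYt _ /=; rewrite min_l.
by apply: le_Ex => // t; rewrite ge_min lexx orbT.
Qed.

Variables (A : 'M[R]_N) (p q e f beta sigma : 'I_N -> R).
Variables (J : 'I_N -> 'rV[R]_M -> R) (g : 'I_N -> 'rV[R]_M -> 'rV[R]_M).
Variables (wstar : 'rV[R]_M) (gstar : 'I_N -> 'rV[R]_M) (mu_o : R).
Variable ghat : 'I_N -> nat -> 'rV[R]_M -> T -> 'rV[R]_M.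
Hypothesis A_stoch : left_stochastic A.
Hypothesis J_lip : forall k, affine_lipschitz_subgradients (e k) (f k) (J k).
Hypothesis g_sub : forall k w, subdifferential (J k) w (g k w).
Hypothesis gstar_sub : forall k, subdifferential (J k) wstar (gstar k).

Definition iterate_noise i (k : 'I_N) (t : T) : 'rV[R]_M :=
  noise g ghat k i.+1 (w i k t) t.

Hypothesis w_step : forall i k t,
  w i.+1 k t = step A p q g mu_o ((w i)^~ t) ((iterate_noise i)^~ t) k.
Hypothesis w0_L2 : forall k, vL2 P (fun t => w 0%N k t - wstar).
Hypothesis g_adapted : adapted_subgradients g w.
Hypothesis w_noise : noise_moments P (noise g ghat) beta sigma wstar w.

Lemma error_random_vector (Y : T -> 'rV[R]_M) :
  vL2 P (fun t => Y t - wstar) -> random_vector Y.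
Proof.
move=> hY; have := vL2D hY (vL2_cst P wstar).
by under eq_fun do rewrite subrK; move=> h j; case: (h j).
Qed.

Lemma admissible_iterate i :
  (forall j k, (j <= i)%N -> vL2 P (fun t => w j k t - wstar)) ->
  admissible P beta sigma g wstar (w i) (iterate_noise i).
Proof.
move=> hw.
have pm : past w i `<=` measurable.
  by apply: past_measurable => j k ji; apply: error_random_vector; exact: hw.
have hwi k : vL2 P (fun t => w i k t - wstar) by exact: hw.
have hg k : vL2 P (fun t => g k (w i k t)).
  apply: (vL2_subgradient (@g_sub k) (@J_lip k) (gstar_sub k) _ (hwi k)) => j.
  by apply: (measurable_wrt_fun pm); exact: g_adapted.
have hS k : vL2 P (iterate_noise i k).
  have [mean [V [iS _ _ _] _]] := w_noise k (ltn0Sn i).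
  apply: (vL2_of_sq _ (Y := fun t => sq (iterate_noise i k t))) => //.
    by move=> j; have [iSj _ _ _] := mean j; exact: L1_meas iSj.
  by move: iS; rewrite /comp; under eq_fun do rewrite l2norm_sq.
have orth k (Z : T -> 'rV[R]_M) : vL2 P Z ->
    (forall j, measurable_wrt (past w i) (fun t => Z t 0 j)) ->
    Ex P (fun t => dotv (Z t) (iterate_noise i k t)) = 0.
  move=> hZ mZ; have [mean _] := w_noise k (ltn0Sn i).
  rewrite Ex_sum => [|j]; last exact: L2M (hZ j) (hS k j).
  rewrite big1 // => j _; have [iSj _ _ S0] := mean j.
  apply: (Ex_orthogonal pm iSj) => [B FB||]; [|exact: mZ|exact: L2M (hZ j) (hS k j)].
  by rewrite S0 // integral0.
split=> //.
- move=> k l; apply: orth => // j.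
  under eq_fun do rewrite mxE.
  have shift : measurable_fun [set: R] (fun x : R => x + (- wstar) 0 j).
    by apply: measurable_funD => //; exact: measurable_cst.
  exact: (measurable_wrt_comp shift (@past_iterate i l j)).
- by move=> k l; apply: orth => // j; exact: g_adapted.
- move=> k; have [_ [V cV VP]] := w_noise k (ltn0Sn i).
  have -> : beta k ^+ 2 * Ex P (fun t => sq (w i k t - wstar)) + sigma k ^+ 2
    = Ex P (fun t => beta k ^+ 2 * sq (w i k t - wstar) + sigma k ^+ 2).
    rewrite ExD ?Ex_cst ?ExZ //; [exact: L1_dotv| |exact: L1_cst].
    by apply: L1Z; exact: L1_dotv.
  have -> : (fun t => sq (iterate_noise i k t)) =
            (fun t => l2norm (iterate_noise i k t) ^+ 2).
    by apply/funext => t; rewrite l2norm_sq.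
  apply: (cond_expectation_le cV).
    by apply: L1D; [apply: L1Z; exact: L1_dotv|exact: L1_cst].
  by apply: filterS VP => t; rewrite l2norm_sq sqBC.
Qed.

(** The iterates are square-integrable, hence measurable, one time step after
    the other: the hypotheses on the noise at a step only make sense once the
    past is known to consist of measurable sets. *)
Lemma iterate_L2 i k : vL2 P (fun t => w i k t - wstar).
Proof.
elim/ltn_ind: i k => -[|i] IHi k; first exact: w0_L2.
under eq_fun do rewrite w_step.
have adm := @admissible_iterate i (fun j l ji => IHi j ji l).
exact: (error_step_L2 p q A_stoch mu_o adm k).
Qed.

Lemma iterate_admissible i :
  admissible P beta sigma g wstar (w i) (iterate_noise i).
Proof. by apply: admissible_iterate => j k _; exact: iterate_L2. Qed.

End Iterates.

Lemma diffusion_step (R : realType) (N M : nat) (d : measure_display)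
  (T : measurableType d)
  (Nb : 'I_N -> {set 'I_N}) (A : 'M[R]_N) (p q : 'I_N -> R) (mu_o : R)
  (g : 'I_N -> 'rV[R]_M -> 'rV[R]_M)
  (ghat : 'I_N -> nat -> 'rV[R]_M -> T -> 'rV[R]_M) w0 :
  (forall l k, l \notin Nb k -> A l k = 0) ->
  let w := diffusion Nb A (step_size p q mu_o) ghat w0 in
  forall i k t, w i.+1 k t = step A p q g mu_o ((w i)^~ t)
    ((iterate_noise w g ghat i)^~ t) k.
Proof.
move=> A_Nb w i k t; rewrite /w /= /combine /step /mix big_mkcond /=.
apply: eq_bigr => l _; case: ifP => [_|/negbT/A_Nb->]; last by rewrite scale0r.
by rewrite /adapt /iterate_noise /noise [g _ _ + _]addrC subrK.
Qed.

(** * Constants and uniform disagreement *)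

Lemma limn_esup_le_geometric (R : realType) (u : nat -> \bar R) (r b C : R) :
  0 < r < 1 -> (forall n, (u n <= (C * r ^+ n + b)%:E)%E) ->
  (limn_esup u <= b%:E)%E.
Proof.
move=> /andP[r0 r1] ub; apply/lee_addgt0Pr => c c0.
have := @cvg_geometric R C r; rewrite ger0_norm ?(ltW r0) // => /(_ r1).
move=> /cvgrPdist_lt/(_ c c0)[n _ nP].
apply: le_trans (ereal_inf_lbound _) _.
  by exists [set k | (n <= k)%N]; [exists n|reflexivity].
apply: ge_ereal_sup => _ [k /= nk <-]; apply: le_trans (ub k) _.
rewrite -EFinD lee_fin addrC lerD2l.
have := nP k nk; rewrite /= sub0r normrN /geometric /= => /ltW.
exact: le_trans (ler_norm _).
Qed.

Section Constants.
Context {R : realType} {N : nat}.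
Variables (p q eta beta e : 'I_N -> R) (mu_o h : R).
Hypothesis p_gt0 : forall k, 0 < p k.
Hypothesis q_gt0 : forall k, 0 < q k.
Hypothesis eta_gt0 : forall k, 0 < eta k.
Hypothesis mu_o_gt0 : 0 < mu_o.
Hypothesis h_ge0 : 0 <= h.
Let mu := step_size p q mu_o.
Hypothesis small : small_step_sizes p q mu eta beta e h.

(** The condition can be cleared of denominators: a quotient by zero is zero and
    leaves no room for a positive step size. *)
Lemma small_step_size k :
  mu_o * (e k ^+ 2 + beta k ^+ 2 + 2 * h * e k ^+ 2) < eta k.
Proof.
have /andP[mu0] := small k; rewrite lt_min => /andP[_ mu2].
set D := p k * beta k ^+ 2 + _ in mu2.
have D0 : 0 <= D.
  have e2 := sqr_ge0 (e k); have b2 := sqr_ge0 (beta k); have p0 := ltW (p_gt0 k).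
  have := mulr_ge0 p0 b2; have := mulr_ge0 h_ge0 (mulr_ge0 p0 e2).
  have := mulr_ge0 p0 e2; rewrite /D; lra.
have {}D0 : 0 < D.
  rewrite lt_neqAle D0 andbT; apply/eqP => D0'.
  by move: (lt_trans mu0 mu2); rewrite -D0' invr0 mulr0 ltxx.
move: mu2; rewrite ltr_pdivlMr // /mu /step_size /D.
have -> : q k / p k * mu_o * (p k * beta k ^+ 2 + (1 + 2 * h) * p k * e k ^+ 2)
  = q k * (mu_o * (e k ^+ 2 + beta k ^+ 2 + 2 * h * e k ^+ 2)).
  by field; rewrite gt_eqF.
by rewrite (mulrC (eta k)) ltr_pM2l.
Qed.

Lemma rate_term k :
  0 < 1 - mu k * (eta k - mu_o * e k ^+ 2 - mu_o * beta k ^+ 2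
                  - 2 * mu_o * h * e k ^+ 2) < 1.
Proof.
have /andP[mu0] := small k; rewrite lt_min => /andP[mu1 _].
rewrite ltr_pdivlMr // in mu1.
have s := small_step_size k.
have := mulr_gt0 mu0 (_ : 0 < eta k - mu_o * e k ^+ 2 - mu_o * beta k ^+ 2
                  - 2 * mu_o * h * e k ^+ 2).
set c := eta k - _ - _ - _.
have c0 : 0 < c by rewrite /c; lra.
have ce : c <= eta k.
  rewrite /c; have e2 := sqr_ge0 (e k); have b2 := sqr_ge0 (beta k).
  have := mulr_ge0 (ltW mu_o_gt0) e2; have := mulr_ge0 (ltW mu_o_gt0) b2.
  have := mulr_ge0 (mulr_ge0 (ltW mu_o_gt0) h_ge0) e2; lra.
move=> /(_ c0) muc; have := ler_wpM2l (ltW mu0) ce; lra.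
Qed.

Lemma rate_ge k :
  1 - mu k * (eta k - mu_o * e k ^+ 2 - mu_o * beta k ^+ 2
              - 2 * mu_o * h * e k ^+ 2) <= rate mu eta beta e mu_o h.
Proof. by apply: (le_bigmax _ (fun k => 1 - mu k * _)). Qed.

Lemma rate_in01 (k0 : 'I_N) : 0 < rate mu eta beta e mu_o h < 1.
Proof.
apply/andP; split.
  by apply: lt_le_trans (rate_ge k0); case/andP: (rate_term k0).
by apply/bigmax_ltP; split=> // k _; case/andP: (rate_term k).
Qed.

(** Enlarging h strengthens the step-size condition, so a lower bound on h makes
    it imply any prescribed bound on mu_o. *)
Lemma small_mu_o k (m : R) : 0 < m -> eta k ^+ 2 <= e k ^+ 2 ->
  1 / (2 * m * eta k) <= h -> mu_o <= m.
Proof.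
move=> m0 ee hm; have s := small_step_size k.
have e2 := sqr_ge0 (e k); have b2 := sqr_ge0 (beta k).
have eta2 : 0 < eta k ^+ 2 by rewrite exprn_gt0.
have d0 : 0 < 2 * m * eta k by rewrite !mulr_gt0.
rewrite ler_pdivrMr // in hm.
rewrite leNgt; apply/negP => mmu.
have h1 : h * (2 * m * eta k) <= h * (2 * mu_o * eta k).
  by rewrite ler_wpM2l // ler_pM2r // ler_pM2l // ltW.
have h2 : (h * 2 * mu_o) * eta k ^+ 2 <= (h * 2 * mu_o) * e k ^+ 2.
  by rewrite ler_wpM2l // !mulr_ge0 // ltW.
have h3 : eta k <= (h * (2 * mu_o * eta k)) * eta k.
  by rewrite ler_peMl ?(ltW (eta_gt0 k)) // (le_trans hm h1).
have := mulr_ge0 (ltW mu_o_gt0) e2; have := mulr_ge0 (ltW mu_o_gt0) b2.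
rewrite expr2 in h2; lra.
Qed.

End Constants.

Lemma performance_bound_bigO (R : realType) (N M : nat) (q f sigma : 'I_N -> R)
  (gstar : 'I_N -> 'rV[R]_M) (h : R) :
  (performance_bound q f sigma gstar h : R^o -> R^o)
          =O_ ((0 : R)^'+) (fun mu_o : R => mu_o : R^o).
Proof.
rewrite /performance_bound; set c := \sum_k _.
apply/eqO_exP; exists (`|c| + 1); first by rewrite ltr_wpDl.
apply: nearW => mu; rewrite /= !normrM normfV (ger0_norm (ler0n _ 2)).
have := normr_ge0 mu; have := normr_ge0 c; nra.
Qed.

Section Disagreement.
Context {R : realType} {N M : nat} {d : measure_display} {T : measurableType d}.
Variable P : probability T R.
Variables (A : 'M[R]_N) (p q eta e f beta sigma : 'I_N -> R).
Variables (J : 'I_N -> 'rV[R]_M -> R) (g : 'I_N -> 'rV[R]_M -> 'rV[R]_M).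
Variables (wstar : 'rV[R]_M) (gstar : 'I_N -> 'rV[R]_M).
Hypothesis A_stoch : left_stochastic A.
Hypothesis A_conn : strongly_connected A.
Hypothesis A_perron : perron_vector A p.
Hypothesis q_pos : forall k, 0 < q k.
Hypothesis q_sum : \sum_k q k = 1.
Hypothesis eta_pos : forall k, 0 < eta k.
Hypothesis J_sconvex : forall k, strongly_convex (eta k) (J k).
Hypothesis J_lip : forall k, affine_lipschitz_subgradients (e k) (f k) (J k).
Hypothesis g_sub : forall k w, subdifferential (J k) w (g k w).
Hypothesis gstar_sub : forall k, subdifferential (J k) wstar (gstar k).
Hypothesis gstar_sum : \sum_k q k *: gstar k = 0.

(** The constants come from the network, the risks and the noise levels: the
    state enters only through the two mean-square recursions. *)
Lemma uniform_disagreement : exists m D, [/\ 0 < m, 0 <= D &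
  forall mu_o (w S : nat -> 'I_N -> T -> 'rV[R]_M), 0 < mu_o <= m ->
    (forall i k t, w i.+1 k t = step A p q g mu_o ((w i)^~ t) ((S i)^~ t) k) ->
    (forall i, admissible P beta sigma g wstar (w i) (S i)) ->
    exists I, forall i, (I <= i)%N ->
      Ex P (fun t => energy p (spread p ((w i)^~ t))) <= D * mu_o ^+ 2].
Proof.
have p_gt0 k : 0 < p k by case: A_perron.
have [n [r [K [r01 K0 KP]]]] :=
  @disagreement_contraction R N M A p A_stoch A_perron A_conn.
(* weights of Young's inequality, small enough for strong convexity to absorb
   the Lipschitz term *)
pose c l := eta l / (e l ^+ 2 + 1).
have e1 l : 0 < e l ^+ 2 + 1 by rewrite ltr_wpDl // sqr_ge0.
have c0 l : 0 < c l by rewrite divr_gt0.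
have ce l : c l * e l ^+ 2 <= eta l.
  by rewrite mulrAC ler_pdivrMr // ler_pM2l // lerDl.
have [kappa /andP[kappa0 _] kP] :=
  @finite_pos_lower_bound R _ (fun l => q l * eta l / p l)
    (fun l => divr_gt0 (mulr_gt0 (q_pos l) (eta_pos l)) (p_gt0 l)).
have kp l : kappa * p l <= q l * eta l by rewrite -ler_pdivlMr.
pose K1 := \sum_l q l * (c l * f l ^+ 2 + (c l)^-1 * (p l)^-1).
pose K2 := \sum_l q l * ((e l ^+ 2 + beta l ^+ 2) * (p l)^-1
                          + (f l ^+ 2 + sigma l ^+ 2)).
pose K3 := K * \sum_l q l ^+ 2 * (p l)^-1 *
  ((4 * e l ^+ 2 + 2 * beta l ^+ 2) * (p l)^-1
        + (4 * f l ^+ 2 + 4 * sq (gstar l) + 2 * sigma l ^+ 2)).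
have pi l : 0 <= (p l)^-1 by rewrite invr_ge0 ltW.
have q0 l : 0 <= q l by exact: ltW.
have K10 : 0 <= K1.
  apply: sumr_ge0 => l _; rewrite mulr_ge0 // addr_ge0 // mulr_ge0 ?sqr_ge0 //.
    exact: ltW.
  by rewrite invr_ge0 ltW.
have K20 : 0 <= K2.
  apply: sumr_ge0 => l _; have e2 := sqr_ge0 (e l); have f2 := sqr_ge0 (f l).
  have b2 := sqr_ge0 (beta l); have s2 := sqr_ge0 (sigma l).
  apply: mulr_ge0 => //; apply: addr_ge0; last exact: addr_ge0.
  by apply: mulr_ge0 => //; exact: addr_ge0.
have K30 : 0 <= K3.
  rewrite mulr_ge0 //; apply: sumr_ge0 => l _.
  have e2 := sqr_ge0 (e l); have f2 := sqr_ge0 (f l).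
  have b2 := sqr_ge0 (beta l); have s2 := sqr_ge0 (sigma l).
  have g2 := sq_ge0 (gstar l).
  apply: mulr_ge0; first by rewrite mulr_ge0 ?sqr_ge0.
  apply: addr_ge0; last by lra.
  by apply: mulr_ge0 => //; lra.
have Kall : 0 <= K1 + K2 + K3 by rewrite !addr_ge0.
have [m [D [m0 D0 mD]]] := coupled_recursions kappa0 r01 Kall.
exists m, D; split=> // mu_o w S mum wS adm.
have mu0 : 0 < mu_o by case/andP: mum.
pose a i := Ex P (fun t => sq (centroid p ((w i)^~ t) - wstar)).
pose v i := Ex P (fun t => lyapunov A p n.+1 ((w i)^~ t)).
have wE i t : (w i.+1)^~ t = step A p q g mu_o ((w i)^~ t) ((S i)^~ t).
  by apply/funext => k.
have a0 i : 0 <= a i by apply: Ex_ge0 => t; exact: sq_ge0.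
have v0 i : 0 <= v i by apply: Ex_ge0 => t; exact: (lyapunov_ge0 A_perron).
have y0 i : 0 <= a i + v i + 1 by rewrite !addr_ge0.
have mu2 : 0 <= mu_o ^+ 2 by exact: sqr_ge0.
have [|i|I IP] := mD mu_o a v mum a0 v0.
- move=> i; have := stability_recursion A_perron q_pos q_sum J_sconvex J_lip g_sub
    gstar_sub gstar_sum mu0 (adm i) n c0 ce kappa0 kp.
  rewrite -/K1 -/K2 -/(a i) -/(v i).
  have -> : Ex P (fun t => sq (centroid p
      (step A p q g mu_o ((w i)^~ t) ((S i)^~ t)) - wstar)) = a i.+1.
    by congr Ex; apply/funext => t; rewrite wE.
  move=> /le_trans; apply; apply: lerD.
    rewrite lerD2l ler_wpM2r ?addr_ge0 // ler_pM2l //; lra.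
  by rewrite ler_wpM2r // ler_wpM2l //; lra.
- have := disagreement_recursion A_stoch A_perron q_pos J_lip g_sub
    gstar_sub mu0 (adm i) K0 KP.
  rewrite -/K3 -/(a i) -/(v i).
  have -> : Ex P (fun t => lyapunov A p n.+1
      (step A p q g mu_o ((w i)^~ t) ((S i)^~ t))) = v i.+1.
    by congr Ex; apply/funext => t; rewrite wE.
  move=> /le_trans; apply; rewrite lerD2l ler_wpM2r // ler_wpM2l //; lra.
exists I => i /IP; apply: le_trans.
exact: (energy_spread_le_v A_perron (adm i) n).
Qed.

End Disagreement.

(** * Performance of the weighted iterates *)

Theorem corollary1 (R : realType) (N M : nat)
  (Nb : 'I_N -> {set 'I_N}) (A : 'M[R]_N) (p q : 'I_N -> R)
  (Nb_self : forall k, k \in Nb k)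
  (A_stoch : left_stochastic A)
  (A_Nb : forall l k, l \notin Nb k -> A l k = 0)
  (A_conn : strongly_connected A)
  (A_perron : perron_vector A p)
  (q_pos : forall k, 0 < q k) (q_sum : \sum_k q k = 1)
  (d dX : measure_display) (T : measurableType d) (P : probability T R)
  (X : 'I_N -> measurableType dX) (x : forall k, {RV P >-> X k})
  (Q : forall k, 'rV[R]_M -> X k -> R) (J : 'I_N -> 'rV[R]_M -> R)
  (Q_convex : forall k, integrable_convex_loss (Q k) (x k))
  (J_risk : forall k w, J k w = risk (Q k) (x k) w)
  (eta e f : 'I_N -> R)
  (eta_pos : forall k, 0 < eta k)
  (J_sconvex : forall k, strongly_convex (eta k) (J k))
  (J_lipschitz : forall k, affine_lipschitz_subgradients (e k) (f k) (J k))
  (wstar : 'rV[R]_M)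
  (wstar_min : unique_minimizer (fun w => \sum_k q k * J k w) wstar)
  (gstar : 'I_N -> 'rV[R]_M)
  (gstar_sub : forall k, subdifferential (J k) wstar (gstar k))
  (gstar_sum : \sum_k q k *: gstar k = 0)
  (g : 'I_N -> 'rV[R]_M -> 'rV[R]_M)
  (g_sub : forall k w, subdifferential (J k) w (g k w))
  (ghat : 'I_N -> nat -> 'rV[R]_M -> T -> 'rV[R]_M)
  (noise_indep : independent_noise P (noise g ghat))
  (beta sigma : 'I_N -> R)
  (w0 : 'I_N -> T -> 'rV[R]_M)
  (w0_meas : forall k, random_vector (w0 k))
  (w0_moment : forall k, (mean_square P (fun t => w0 k t - wstar)%R < +oo)%E) :
  exists h : R,
    [/\ 0 <= h,
        (performance_bound q f sigma gstar h : R^o -> R^o)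
          =O_ ((0 : R)^'+) (fun mu_o : R => mu_o : R^o) &
        forall mu_o : R, 0 < mu_o ->
        let mu := step_size p q mu_o in
        let w := diffusion Nb A mu ghat w0 in
        small_step_sizes p q mu eta beta e h ->
        adapted_subgradients g w ->
        noise_moments P (noise g ghat) beta sigma wstar w ->
        let alpha := rate mu eta beta e mu_o h in
        let wbar := weighted_iterate alpha w in
        let gap := fun L t =>
          \sum_k q k * J k (wbar k L t) - \sum_k q k * J k wstar in
        let bound := performance_bound q f sigma gstar h mu_o in
        [/\ exists Io : nat, forall i, (0 < i)%N -> (Io <= i)%N -> forall k,
              (mean_square P (fun t => \sum_l p l *: (wstar - w i.-1 l t)
                                        - (wstar - w i.-1 k t))%R
               <= (h ^+ 2 * mu_o ^+ 2)%:E)%E,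
            0 < alpha < 1,
            forall L, P.-integrable [set: T] (EFin \o gap L),
            (limn_esup (fun L => 'E_P[gap L]) <= bound%:E)%E &
            exists C : R, forall L : nat,
              ('E_P[gap L] <= (C * alpha ^+ L + bound)%:E)%E]].
Proof.
have p_gt0 k : 0 < p k by case: A_perron.
have p_sum : \sum_k p k = 1 by case: A_perron.
have [k0 _] : exists k0 : 'I_N, True.
  apply: contrapT => noagent; move: q_sum; rewrite big1 => [|k _].
    by move=> /esym/eqP; rewrite oner_eq0.
  by exfalso; apply: noagent; exists k.
have [m [D [m0 D0 disagreement]]] := uniform_disagreement P beta sigma A_stoch
  A_conn A_perron q_pos q_sum eta_pos J_sconvex J_lipschitz g_sub gstar_sub
  gstar_sum.
pose D' := D * \sum_k (p k)^-1.
have D'0 : 0 <= D'.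
  by rewrite mulr_ge0 // sumr_ge0 // => k _; rewrite invr_ge0 ltW.
(* the first summand bounds the disagreement; the second one makes the step-size
   condition imply mu_o <= m *)
pose h := Num.sqrt D' + 1 / (2 * m * eta k0).
have hk0 : 0 < 1 / (2 * m * eta k0) by rewrite divr_gt0 // !mulr_gt0.
have h0 : 0 < h by rewrite ltr_wpDl // sqrtr_ge0.
have D'h : D' <= h ^+ 2.
  rewrite -[leLHS]sqr_sqrtr // ler_pXn2r ?nnegrE ?sqrtr_ge0 ?(ltW h0) //.
  by rewrite lerDl ltW.
exists h; split; [exact: ltW|exact: performance_bound_bigO|].
move=> mu_o mu_o0 mu w small adapted moments alpha wbar gap bound.
have w0_L2 k : vL2 P (fun t => w 0%N k t - wstar).
  apply: vL2_mean_square => // j; under eq_fun do rewrite mxE.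
  by apply: measurable_funD; [exact: w0_meas|exact: measurable_cst].
have w_step := diffusion_step p q mu_o g ghat w0 A_Nb.
have adm i : admissible P beta sigma g wstar (w i) (iterate_noise w g ghat i).
  exact: (iterate_admissible A_stoch J_lipschitz g_sub gstar_sub w_step w0_L2
    adapted moments).
have w_L2 i k : vL2 P (fun t => w i k t - wstar) := error_L2 (adm i) k.
have [I IP] : exists I, forall i, (I <= i)%N -> forall k,
    Ex P (fun t => sq (spread p ((w i)^~ t) k)) <= h ^+ 2 * mu_o ^+ 2.
  have [I IP] : exists I, forall i, (I <= i)%N ->
      Ex P (fun t => energy p (spread p ((w i)^~ t))) <= D * mu_o ^+ 2.
    have [M0|M0] := posnP M.
      exists 0%N => i _.
      have -> : (fun t => energy p (spread p ((w i)^~ t))) = (fun=> 0).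
        apply/funext => t; rewrite /energy big1 // => k _.
        by rewrite /dotv big1 ?mulr0 // => -[j jM]; exfalso; move: jM; rewrite M0.
      by rewrite Ex_cst mulr_ge0 // sqr_ge0.
    apply: (disagreement mu_o w (iterate_noise w g ghat)) => //.
    rewrite mu_o0 /=; apply: (small_mu_o p_gt0 q_pos eta_pos mu_o0 (ltW h0) small
      (k := k0)) => //.
      exact: (sconvex_le_lipschitz (@J_sconvex k0) M0 (eta_pos k0) (g_sub k0)
        (@J_lipschitz k0)).
    by rewrite lerDr sqrtr_ge0.
  exists I => i /IP hi k; apply: le_trans (Ex_sq_spread_le A_perron (adm i) k) _.
  apply: (@le_trans _ _ ((p k)^-1 * (D * mu_o ^+ 2))).
    by rewrite ler_wpM2l // invr_ge0 ltW.
  rewrite mulrCA mulrA; apply: (@le_trans _ _ (D' * mu_o ^+ 2)).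
    rewrite ler_wpM2r ?sqr_ge0 // ler_wpM2l // (bigD1 k) //= lerDl.
    by apply: sumr_ge0 => l _; rewrite invr_ge0 ltW.
  by rewrite ler_wpM2r ?sqr_ge0.
have alpha01 : 0 < alpha < 1.
  exact: (rate_in01 p_gt0 q_pos eta_pos mu_o0 (ltW h0) small k0).
have /andP[alpha0 alpha1] := alpha01.
pose S L := \sum_(j < L.+1) alpha ^+ (L - j).
have S0 L : 0 < S L.
  rewrite /S big_ord_recr /= subnn expr0 ltr_wpDl // sumr_ge0 // => j _.
  by rewrite exprn_ge0 // ltW.
pose r L (j : 'I_L.+1) := alpha ^+ (L - j) / S L.
have r0 L j : 0 <= r L j.
  by apply: divr_ge0; [apply: exprn_ge0|]; exact: ltW.
have r1 L : \sum_j r L j = 1 by rewrite /r -mulr_suml -/(S L) divff // gt_eqF.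
have wbarE k L t : wbar k L t = \sum_j r L j *: w j k t by [].
have wbar_L2 k L : vL2 P (fun t => wbar k L t - wstar).
  have -> : (fun t => wbar k L t - wstar) =
            (fun t => \sum_j r L j *: (w j k t - wstar)).
    apply/funext => t; under eq_bigr do rewrite scalerBr.
    by rewrite sumrB -scaler_suml r1 scale1r.
  by apply: vL2_sum => j; apply: vL2Z.
have J_L1 k (Y : T -> 'rV[R]_M) : vL2 P (fun t => Y t - wstar) ->
    L1 P (fun t => J k (Y t)).
  move=> hY; apply: (L1_risk (g_sub k) (@J_lipschitz k) (gstar_sub k) _ hY).
  exact: error_random_vector hY.
have gap_L1 L : L1 P (gap L).
  apply: L1B; last exact: L1_cst.
  by apply: L1_sum => k; apply: L1Z; exact: J_L1.
pose a i := Ex P (fun t => sq (centroid p ((w i)^~ t) - wstar)).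
pose excess i := \sum_l q l * (Ex P (fun t => J l (w i l t)) - J l wstar).
have descent i : (I <= i)%N ->
    excess i <= alpha * (a i / (2 * mu_o)) - a i.+1 / (2 * mu_o) + bound.
  move=> /IP dis.
  have := descent_recursion A_perron q_pos q_sum J_sconvex J_lipschitz g_sub
    gstar_sub gstar_sum mu_o0 (adm i) h0 dis
    (rate_ge p q eta beta e mu_o h) (ltW alpha1).
  have -> : Ex P (fun t => sq (centroid p
      (step A p q g mu_o ((w i)^~ t) ((iterate_noise w g ghat i)^~ t)) - wstar))
      = a i.+1.
    congr Ex; apply/funext => t.
    suff -> : step A p q g mu_o ((w i)^~ t) ((iterate_noise w g ghat i)^~ t)
      = (w i.+1)^~ t by [].
    by apply/funext => k; rewrite -w_step.
  rewrite -/(a i) -/(excess i) -/alpha -/bound => le_a.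
  have mu2 : 0 < 2 * mu_o by rewrite mulr_gt0.
  rewrite -(ler_pM2l mu2); apply: (@le_trans _ _
    (alpha * a i - a i.+1 + 2 * mu_o * bound)); first by lra.
  by rewrite le_eqVlt; apply/orP; left; apply/eqP; field; rewrite gt_eqF.
have [C CP] : exists C, forall L, Ex P (gap L) <= C * alpha ^+ L + bound.
  have a0 i : 0 <= a i / (2 * mu_o).
    by rewrite divr_ge0 ?mulr_ge0 ?(ltW mu_o0) // Ex_ge0 // => t; exact: sq_ge0.
  have [C CP] := weighted_mean_le alpha01 a0 descent.
  exists C => L; apply: le_trans (CP L).
  have iJ (j : 'I_L.+1) k : L1 P (fun t => J k (w j k t)) by exact: J_L1.
  have -> : \sum_(j < L.+1) alpha ^+ (L - j) / S L * excess j = Ex P (fun t =>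
      \sum_k q k * (\sum_j r L j * J k (w j k t)) - \sum_k q k * J k wstar).
    have i1 k : L1 P (fun t => \sum_j r L j * J k (w j k t)).
      by apply: L1_sum => j; exact: L1Z.
    rewrite ExB; [|by apply: L1_sum => k; exact: L1Z|exact: L1_cst].
    rewrite Ex_cst Ex_sum => [|k]; last exact: L1Z.
    have -> : \sum_k Ex P (fun t => q k * \sum_j r L j * J k (w j k t)) =
        \sum_k \sum_j r L j * (q k * Ex P (fun t => J k (w j k t))).
      apply: eq_bigr => k _; rewrite ExZ // Ex_sum => [|j]; last exact: L1Z.
      by rewrite mulr_sumr; apply: eq_bigr => j _; rewrite ExZ // mulrCA.
    rewrite exchange_big /= -[X in _ - X]mul1r -(r1 L) mulr_suml -sumrB.
    apply: eq_bigr => j _; rewrite -mulr_sumr -mulrBr; congr (_ * _).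
    by rewrite -sumrB; apply: eq_bigr => k _; rewrite mulrBr.
  apply: le_Ex => //.
    apply: L1B; last exact: L1_cst.
    by apply: L1_sum => k; apply: L1Z; apply: L1_sum => j; exact: L1Z.
  move=> t; rewrite lerD2r; apply: ler_sum => k _; rewrite ler_pM2l //.
  by rewrite wbarE; exact: (risk_jensen (g_sub k)).
have CE L : ('E_P[gap L] <= (C * alpha ^+ L + bound)%:E)%E.
  by rewrite expectation_Ex // lee_fin.
split=> //.
- exists I.+1 => -[//|i] _ Ii k /=.
  have E t : \sum_l p l *: (wstar - w i l t) - (wstar - w i k t)
      = spread p ((w i)^~ t) k.
    under eq_bigr do rewrite scalerBr.
    by rewrite sumrB -scaler_suml p_sum scale1r opprB addrC addrA subrK.
  under [X in mean_square P X]eq_fun do rewrite E.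
  rewrite mean_square_Ex; last exact: (spread_L2 A_perron (adm i)).
  by rewrite lee_fin; exact: IP.
- exact: (limn_esup_le_geometric alpha01 CE).
- by exists C.
Qed.
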